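(* Let $n\ge2$ and let $(G,R)$ be an abelian cyclically ordered group. The following conditions are equivalent. (1) The linearly ordered group $\mathrm{uw}(G)$ is $n$-regular. (2) $G$ is c-$n$-regular. (3) Either $G$ is c-archimedean, or $l(G)$ is $n$-regular, $K(G)$ is $n$-divisible and $K(G)$ contains a primitive $n$-th root of $1$. (4) The quotient of $G$ by every proper c-convex subgroup is c-$n$-divisible.
   Context: All groups are abelian, written additively except subgroups of $\mathbb{K}$. A cyclically ordered group $(G,R)$ is an abelian group $G$ with a ternary relation $R$ such that: $R(a,b,c)$ implies that $a,b,c$ are pairwise distinct; $R(a,b,c)\Rightarrow R(b,c,a)$; for every $c\in G$, $R(c,\cdot,\cdot)$ is a strict linear order on $G\setminus\{c\}$; $R(a,b,c)\Rightarrow R(a+u,b+u,c+u)$. $\mathbb{K}$ is the group of complex numbers of modulus $1$, cyclically ordered by: for $0\le\theta_1,\theta_2,\theta_3<2\pi$, $R(e^{i\theta_1},e^{i\theta_2},e^{i\theta_3})$ iff $\theta_1<\theta_2<\theta_3$ up to cyclic permutation of the indices. The unwound of $(G,R)$ is the linearly ordered group $\mathrm{uw}(G)$ with underlying set $\mathbb{Z}\times G$, where $(n,c)<(n',c')$ iff $n<n'$, or $n=n'$ and $R(0,c,c')$, or $n=n'$ and $c=0\ne c'$; the addition is $(m,a)+(n,b)=(m+n,a+b)$ if $a=0$ or $b=0$ or $R(0,a,a+b)$, and $(m+n+1,a+b)$ if $R(0,a+b,a)$ or $a+b=0\neq a$. Put $z_G=(1,0)$; it is positive and cofinal, and $G\simeq\mathrm{uw}(G)/\langle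 z_G\rangle$. Let $C$ be the greatest proper convex subgroup of $\mathrm{uw}(G)$ (so $-z_G<C<z_G$). The linear part $l(G)$ is the image of $C$ in $G$ (an isomorphic copy of $C$), with the linear order inherited from $\mathrm{uw}(G)$. $K(G)=G/l(G)$ is cyclically ordered by: for $a,b,c$ in pairwise distinct classes, $R(\bar a,\bar b,\bar c)$ iff $R(a,b,c)$. $K(G)$ embeds, as a cyclically ordered group, in $\mathbb{K}$, and is identified with its image. $G$ is c-archimedean if $l(G)=\{0\}$ (equivalently $G$ is isomorphic to a subgroup of $\mathbb{K}$). The proper c-convex subgroups of $G$ are exactly the convex subgroups of $l(G)$ different from $\{0\}$ ($l(G)$ itself included when it is nonzero, even if $l(G)=G$). A cyclically ordered group is c-$n$-divisible if it is $n$-divisible as a group and contains a subgroup isomorphic to the cyclic group generated by a primitive $n$-th root of $1$ in $\mathbb{C}$. $R(x_1,\dots,x_m)$ (with $m\ge3$) means that $R(x_i,x_j,x_k)$ holds for all $1\le i<j<k\le m$. $(G,R)$ is c-$n$-regular if for all $x_1,\dots,x_n\in G$ with $R(0,x_1,\dots,x_n)$ there is $x\in G$ such that ($nx=x_1$ or $nx=x_n$ or $R(x_1,nx,x_n)$) and $R(0,x,\dots,(n-1)x,x_n)$. A linearly ordered abelian group is $n$-regular if for all $0<x_1<\cdots<x_n$ there is $x$ with $x_1\le nx\le x_n$; ''$l(G)$ is $n$-regular'' is meant in this sense. *)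

(* Defs.v *)
From HB Require Import structures.
From mathcomp Require Import all_boot all_order all_algebra.
From mathcomp Require Import boolp reals trigo.
From mathcomp Require Import complex zify.
Set Implicit Arguments.
Unset Strict Implicit.
Unset Printing Implicit Defensive.
Import Order.TTheory GRing.Theory Num.Theory.
Local Open Scope ring_scope.

HB.mixin Record isCyclicallyOrdered G of GRing.Zmodule G := {
  cyc : G -> G -> G -> Prop;
  cyc_neq : forall a b c, cyc a b c -> [/\ a <> b, b <> c & a <> c];
  cyc_rot : forall a b c, cyc a b c -> cyc b c a;
  cyc_trans : forall c x y z, cyc c x y -> cyc c y z -> cyc c x z;
  cyc_total : forall c x y, x <> c -> y <> c -> x <> y ->
    cyc c x y \/ cyc c y x;
  cyc_add : forall a b c u, cyc a b c -> cyc (a + u) (b + u) (c + u) }.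

#[short(type="cycZmodType")]
HB.structure Definition CycZmodule :=
  {G of GRing.Zmodule G & isCyclicallyOrdered G}.

Arguments cyc_neq {s} [a b c] _.
Arguments cyc_rot {s} [a b c] _.
Arguments cyc_trans {s} [c x y z] _ _.
Arguments cyc_total {s} [c x y] _ _ _.
Arguments cyc_add {s} [a b c] u _.

Section LinearlyOrderedGroups.
Variables (V : zmodType) (lt : V -> V -> Prop).

Record linear_group_order : Prop := {
  lgo_irr : forall x, ~ lt x x;
  lgo_trans : forall x y z, lt x y -> lt y z -> lt x z;
  lgo_total : forall x y, x <> y -> lt x y \/ lt y x;
  lgo_add : forall x y u, lt x y -> lt (x + u) (y + u) }.

Definition convex (H : {pred V}) : Prop :=
  forall a b x, a \in H -> b \in H -> lt a x -> lt x b -> x \in H.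

(* Only the values x 1, ..., x n of the sequence matter. *)
Definition n_regular (n : nat) : Prop :=
  forall x : nat -> V,
    lt 0 (x 1%N) -> (forall i, (0 < i < n)%N -> lt (x i) (x i.+1)) ->
  exists y : V, (x 1%N = y *+ n \/ lt (x 1%N) (y *+ n)) /\
                (y *+ n = x n \/ lt (y *+ n) (x n)).

Hypothesis ltP : linear_group_order.

Lemma lgo_opp x y : lt x y -> lt (- y) (- x).
Proof.
move=> xy; have := lgo_add ltP (- x - y) xy.
by rewrite addrA subrr add0r addrCA subrr addr0.
Qed.

Lemma lgo_opp0 x : lt x 0 -> lt 0 (- x).
Proof. by move=> /lgo_opp; rewrite oppr0. Qed.

Lemma convex_chain (H H' : {pred V}) :
    zmod_closed H -> zmod_closed H' -> convex H -> convex H' ->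
  {subset H <= H'} \/ {subset H' <= H}.
Proof.
move=> zH zH' cH cH'.
have oppH (K : {pred V}) : zmod_closed K -> forall x, - x \in K -> x \in K.
  by move=> [K0 KB] x xK; rewrite -[x]opprK -sub0r; apply: KB.
have [s|/existsNP[x]] := pselect {subset H <= H'}; first by left.
move=> /not_implyP[xH xH']; right => y yH'.
wlog xp : x xH xH' / lt 0 x.
  move=> W; have [x0|xn0] := pselect (x = 0).
    by case: xH'; rewrite x0; case: zH'.
  have [/lgo_opp0 lx|lx] := lgo_total ltP xn0; last exact: (W x).
  apply: (W (- x)) => //; first by apply: oppH; rewrite ?opprK.
  by move=> /(oppH _ zH').
wlog yp : y yH' / lt 0 y.
  move=> W; have [->|yn0] := pselect (y = 0); first by case: zH.
  have [/lgo_opp0 ly|ly] := lgo_total ltP yn0; last exact: (W y).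
  by apply: (oppH H) => //; apply: W => //; apply: (oppH H'); rewrite ?opprK.
have [->//|yx] := pselect (y = x).
have [ly|ly] := lgo_total ltP yx.
  exact: (cH 0 x y zH.1 xH yp ly).
by case: xH'; exact: (cH' 0 y x zH'.1 yH' xp ly).
Qed.

End LinearlyOrderedGroups.

Section Unwound.
Variable G : cycZmodType.
Implicit Types a b c x y : G.

(* c <0 c' iff R(0,c,c') or c = 0 <> c'. *)
Definition lt0 c c' : Prop := cyc 0 c c' \/ (c = 0 /\ c' <> 0).

(* true exactly when R(0,a+b,a) or a+b = 0 <> a, see carry_cases. *)
Definition carry a b : bool := `[< lt0 (a + b) a >].

Lemma cyc_asym a b c : cyc a b c -> ~ cyc a c b.
Proof. by move=> h /(cyc_trans h) /cyc_neq[]. Qed.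

Lemma lt0_irr x : ~ lt0 x x.
Proof. by case=> [/cyc_neq[]//|[]]. Qed.

Lemma lt0_trans x y z : lt0 x y -> lt0 y z -> lt0 x z.
Proof.
case=> [xy|[-> yn0]] [yz|[y0 zn0]].
- by left; apply: cyc_trans yz.
- by rewrite y0 in xy; case: (cyc_neq xy).
- by right; split=> //; case: (cyc_neq yz) => _ _ /nesym.
- by [].
Qed.

Lemma lt0_total x y : x <> y -> lt0 x y \/ lt0 y x.
Proof.
move=> xy; have [x0|x0] := pselect (x = 0).
  by left; right; split=> // y0; apply: xy; rewrite x0 y0.
have [y0|y0] := pselect (y = 0); first by right; right.
by have [] := cyc_total x0 y0 xy; [left; left|right; left].
Qed.

Lemma lt0_nge x y : lt0 x y -> ~ lt0 y x.
Proof. by move=> xy /(lt0_trans xy) /lt0_irr. Qed.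

Lemma lt00 x : ~ lt0 x 0.
Proof. by case=> [/cyc_neq[]//|[]]. Qed.

Lemma carryP a b : carry a b <-> cyc 0 (a + b) a \/ (a + b = 0 /\ a <> 0).
Proof. by split=> [/asboolP|h] //; apply/asboolP. Qed.

Lemma carry_cases a b :
  ~~ carry a b <-> [\/ a = 0, b = 0 | cyc 0 a (a + b)].
Proof.
split.
  move=> /asboolP h; have [|a0] := pselect (a = 0); first by constructor 1.
  have [|b0] := pselect (b = 0); first by constructor 2.
  have ab : a <> a + b by move=> /eqP; rewrite -subr_eq0 opprD addNKr oppr_eq0 => /eqP.
  by have [[|[]]|] := lt0_total ab => //; constructor 3.
case=> [->|->|ab]; apply/asboolP.
- exact: lt00.
- by rewrite addr0; apply: lt0_irr.
- by apply: lt0_nge; left.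
Qed.

Lemma cyc_of_lt0 p q r : lt0 p q -> lt0 q r -> cyc p q r.
Proof.
move=> pq [qr|[q0 _]]; last by case: (@lt00 p); rewrite -q0.
case: pq => [pq|[-> //]].
have h := cyc_trans (cyc_rot qr) (cyc_rot (cyc_rot pq)).
by apply: cyc_rot; apply: cyc_rot.
Qed.

Lemma carry_cocycle a b c :
  (carry a b + carry (a + b)%R c = carry b c + carry a (b + c)%R)%N.
Proof.
rewrite /carry addrA.
set p := a; set q := a + b; set r := q + c.
have T1 : p <> r -> q <> p -> r <> q -> lt0 (b + c) b <-> cyc p r q.
  move=> pr qp rq; have b0 : b <> 0 by move=> b0; apply: qp; rewrite /q b0 addr0.
  have bc0 : b + c <> 0.
    by move=> bc0; apply: pr; rewrite /r /q -addrA bc0 addr0.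
  have -> : q = b + p by rewrite addrC.
  have -> : r = b + c + p by rewrite addrC addrA.
  split=> [[h|[]]//|h].
    by have := cyc_add p h; rewrite add0r.
  by left; have := cyc_add (- p) h; rewrite subrr !addrK.
have [qp|qp] := pselect (q = p).
  have b0 : b = 0 by apply: (addrI a); rewrite addr0.
  have -> : `[< lt0 q p >] = false by apply/asboolP; rewrite qp; apply: lt0_irr.
  have -> : `[< lt0 (b + c) b >] = false.
    by apply/asboolP; rewrite b0; apply: lt00.
  by rewrite qp.
have [rq|rq] := pselect (r = q).
  have c0 : c = 0 by apply: (addrI q); rewrite addr0.
  have -> : `[< lt0 r q >] = false by apply/asboolP; rewrite rq; apply: lt0_irr.
  have -> : `[< lt0 (b + c) b >] = false.
    by apply/asboolP; rewrite c0 addr0; apply: lt0_irr.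
  by rewrite rq addn0.
have [pr|pr] := pselect (p = r).
  have bc0 : b + c = 0 by apply: (addrI a); rewrite addr0 addrA.
  have b0 : b <> 0 by move=> b0; apply: qp; rewrite /q b0 addr0.
  have -> : `[< lt0 (b + c) b >] = true.
    by apply/asboolP; right.
  have -> : `[< lt0 r p >] = false by apply/asboolP; rewrite pr; apply: lt0_irr.
  rewrite -pr; have [h|h] := lt0_total qp.
    by rewrite (asboolT h) (asboolF (lt0_nge h)).
  by rewrite (asboolT h) (asboolF (lt0_nge h)).
have {}T1 := T1 pr qp rq.
have cF : cyc p q r -> ~ lt0 (b + c) b by move=> /cyc_asym h /T1.
have [h1|h1] := lt0_total qp; have [h2|h2] := lt0_total rq;
  have [h3|h3] := lt0_total pr;
  rewrite ?(asboolT h1) ?(asboolF (lt0_nge h1)) ?(asboolT h2)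
    ?(asboolF (lt0_nge h2)) ?(asboolT h3) ?(asboolF (lt0_nge h3)).
all: try by case: (lt0_irr (lt0_trans h1 (lt0_trans h2 h3))).
all: try by case: (lt0_irr (lt0_trans h1 (lt0_trans h3 h2))).
- by rewrite (asboolT (T1.2 (cyc_rot (cyc_rot (cyc_of_lt0 h2 h1))))).
- by rewrite (asboolT (T1.2 (cyc_rot (cyc_of_lt0 h1 h3)))).
- by rewrite (asboolF (cF (cyc_rot (cyc_rot (cyc_of_lt0 h2 h3))))).
- by rewrite (asboolT (T1.2 (cyc_of_lt0 h3 h2))).
- by rewrite (asboolF (cF (cyc_rot (cyc_of_lt0 h3 h1)))).
- by rewrite (asboolF (cF (cyc_of_lt0 h1 h2))).
Qed.

Lemma carryC a b : carry a b = carry b a.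
Proof.
have W x y : carry x y -> carry y x.
  rewrite !carryP => -[xs|[s0 x0]]; last first.
    right; split; first by rewrite addrC.
    by move=> y0; apply: x0; rewrite -s0 y0 addr0.
  apply/carryP/negPn/negP => /carry_cases; rewrite [y + x]addrC.
  case=> [y0|x0|ys].
  - by move: xs; rewrite y0 addr0 => /cyc_neq[].
  - by case: (cyc_neq xs) => _ _; rewrite x0.
  have e1 := cyc_rot (cyc_add (- y) ys).
  have e2 := cyc_rot (cyc_rot (cyc_add (- x) xs)).
  have e3 := cyc_rot (cyc_rot (cyc_add (- (x + y)) ys)).
  have e4 := cyc_rot (cyc_add (- (x + y)) xs).
  move: e1 e2 e3 e4; rewrite !add0r !subrr addrK addrAC subrr add0r.
  rewrite opprD addrCA subrr addr0 addrA subrr add0r => e1 e2 e3 e4.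
  have /cyc_neq[_ /(_ erefl)] // := cyc_trans e2 (cyc_trans ys (cyc_trans xs
    (cyc_trans e1 (cyc_trans e4 e3)))).
by apply/idP/idP; apply: W.
Qed.

(* A record rather than int * G, which carries the componentwise addition. *)
Record uw : Type := Uw { uw_int : int; uw_elt : G }.

Definition uw_pair (p : uw) : int * G := (uw_int p, uw_elt p).
Lemma uw_pairK : cancel uw_pair (fun p => Uw p.1 p.2).
Proof. by case. Qed.

HB.instance Definition _ := Choice.copy uw (can_type uw_pairK).

Definition uw_zero : uw := Uw 0 0.
Definition uw_add (p q : uw) : uw :=
  Uw (uw_int p + uw_int q + (carry (uw_elt p) (uw_elt q))%:Z)
     (uw_elt p + uw_elt q).
Definition uw_opp (p : uw) : uw :=
  Uw (- uw_int p - (carry (uw_elt p) (- uw_elt p))%:Z)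
     (- uw_elt p).

Lemma uw_addA : associative uw_add.
Proof.
move=> [m a] [n b] [k c]; rewrite /uw_add /=; congr Uw; last exact: addrA.
have := carry_cocycle a b c => /(congr1 Posz); rewrite !PoszD => h.
by lia.
Qed.

Lemma uw_addC : commutative uw_add.
Proof.
move=> [m a] [n b]; rewrite /uw_add /=; congr Uw; last exact: addrC.
by rewrite carryC [m + n]addrC.
Qed.

Lemma uw_add0 : left_id uw_zero uw_add.
Proof.
move=> [m a]; rewrite /uw_add /= !add0r.
have /negbTE -> : ~~ carry 0 a by apply/carry_cases; constructor 1.
by rewrite addr0.
Qed.

Lemma uw_addN : left_inverse uw_zero uw_opp uw_add.
Proof.
move=> [m a]; rewrite /uw_add /uw_opp /= addNr carryC.
by rewrite addrAC addrNK addNr.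
Qed.

HB.instance Definition _ :=
  GRing.isZmodule.Build uw uw_addA uw_addC uw_add0 uw_addN.

Definition uw_lt (p q : uw) : Prop :=
  uw_int p < uw_int q \/
  uw_int p = uw_int q /\ lt0 (uw_elt p) (uw_elt q).

Lemma uw_lt_add p d : uw_lt p (p + d) <-> 0 <= uw_int d /\ d <> 0.
Proof.
case: p d => m a [k b]; rewrite /uw_lt /=.
have d0 : Uw k b <> 0 <-> k <> 0 \/ b <> 0.
  split=> [h|[h|h] [? ?] //]; apply: contrapT => /not_orP[/contrapT k0 /contrapT b0].
  by apply: h; rewrite k0 b0.
rewrite d0 /carry; case: asboolP => h.
  have b0 : b <> 0 by move=> b0; case: (@lt0_irr a); rewrite b0 addr0 in h.
  have nab := lt0_nge h.
  by split=> [[mk|[_ //]]|[k0 _]]; [split; [lia|by right]|left; lia].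
split=> [[mk|[mk ab]]|[k0 kb]].
- by split; [lia|left; lia].
- split; first by lia.
  by right=> b0; case: (@lt0_irr a); rewrite b0 addr0 in ab.
- have [k00|] := pselect (k = 0); last by move=> ?; left; lia.
  right; split; first by lia.
  have b0 : b <> 0 by case: kb.
  have [|//|//] := @lt0_total a (a + b).
  by move=> /esym/eqP; rewrite -subr_eq0 addrAC subrr add0r => /eqP.
Qed.

Lemma uw_ltE p q : uw_lt p q <-> 0 <= uw_int (q - p) /\ q <> p.
Proof.
have e : q = p + (q - p) by rewrite addrC subrK.
rewrite {1}e uw_lt_add; split=> -[? h]; split=> // h'; apply: h.
  by rewrite h' subrr.
by rewrite e h' addr0.
Qed.

Lemma uw_ltP : linear_group_order uw_lt.
Proof.
split=> [p|p q r|p q pq|p q u].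
- by rewrite uw_ltE => -[].
- case=> [pq|[pq pq']] [qr|[qr qr']]; rewrite /uw_lt; try by left; lia.
  by right; split; [lia|exact: lt0_trans qr'].
- case: p q pq => [m a] [n b] pq; rewrite /uw_lt /=.
  have [mn|mn|mn] := ltgtP m n; [by left; left|by right; left|].
  have [|ab|ba] := @lt0_total a b; last 2 first.
  + by left; right.
  + by right; right.
  by move=> ab; apply: pq; rewrite mn ab.
- rewrite !uw_ltE opprD addrACA subrr addr0 => -[? h]; split=> //.
  by move=> /addIr.
Qed.

Definition uw_z : uw := Uw 1 0.

(* The union of the proper convex subgroups of uw, which is the greatest one
   by uw_core_closed, uw_core_convex, uw_core_proper and uw_core_max. *)
Definition uw_core : {pred uw} := [pred p | `[< exists H : {pred uw},
  [/\ zmod_closed H, convex uw_lt H, exists q, q \notin H & p \in H] >]].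

Lemma uw_core_max (H : {pred uw}) : zmod_closed H -> convex uw_lt H ->
  (exists q, q \notin H) -> {subset H <= uw_core}.
Proof. by move=> ? ? ? p pH; apply/asboolP; exists H. Qed.

Lemma uw_addZ (m n : int) : Uw m 0 + Uw n 0 = Uw (m + n) 0.
Proof.
have -> : Uw m 0 + Uw n 0 = uw_add (Uw m 0) (Uw n 0) by [].
rewrite /uw_add /= addr0 /carry; congr Uw.
by rewrite (asboolF (@lt00 _)) addr0.
Qed.

Lemma uw_z_cofinal (H : {pred uw}) :
  zmod_closed H -> convex uw_lt H -> uw_z \in H -> forall p, p \in H.
Proof.
move=> [H0 HB] cH Hz.
have HN p : p \in H -> - p \in H by move=> ?; rewrite -sub0r HB.
have Hn (n : nat) : Uw n%:Z 0 \in H.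
  elim: n => [//|n IH].
  have -> : Uw n.+1%:Z 0 = Uw n%:Z 0 - - uw_z.
    by rewrite /uw_z opprK uw_addZ; congr Uw; lia.
  by rewrite HB ?HN.
have Hm (m : int) : Uw m 0 \in H.
  case: (intP m) => [//|n|n]; first exact: Hn.
  have -> : Uw (- n.+1%:Z) 0 = - (Uw n.+1%:Z 0).
    by apply/eqP; rewrite -addr_eq0 uw_addZ addNr.
  exact: HN.
move=> [m a]; apply: (cH (Uw (m - 1) 0) (Uw (m + 1) 0)) => //; left => /=; lia.
Qed.

Lemma uw_core_proper : uw_z \notin uw_core.
Proof.
apply/asboolP => -[H [zH cH [q /negP qH] zz]].
by apply: qH; apply: uw_z_cofinal.
Qed.

Lemma uw_core_closed : zmod_closed uw_core.
Proof.
pose Z : {pred uw} := [pred p | p == 0].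
split.
  apply/asboolP; exists Z; split; last exact: eqxx.
  - by split=> [|p q]; rewrite !inE// => /eqP-> /eqP->; rewrite subrr.
  - move=> a b x; rewrite !inE => /eqP-> /eqP->.
    by move=> /(lgo_trans uw_ltP) h /h /(lgo_irr uw_ltP).
  - by exists uw_z; rewrite inE.
move=> p q /asboolP[H [zH cH pH Hp]] /asboolP[H' [zH' cH' pH' Hq]].
apply/asboolP; have [s|s] := convex_chain uw_ltP zH zH' cH cH'.
  by exists H'; split=> //; apply: zH'.2 => //; apply: s.
by exists H; split=> //; apply: zH.2 => //; apply: s.
Qed.

Lemma uw_core_convex : convex uw_lt uw_core.
Proof.
move=> p q x /asboolP[H [zH cH pH Hp]] /asboolP[H' [zH' cH' pH' Hq]] px xq.
apply/asboolP; have [s|s] := convex_chain uw_ltP zH zH' cH cH'.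
  by exists H'; split=> //; apply: (cH' p q) => //; apply: s.
by exists H; split=> //; apply: (cH p q) => //; apply: s.
Qed.

HB.instance Definition _ := GRing.isZmodClosed.Build uw uw_core uw_core_closed.

Definition lin_part : {pred G} :=
  [pred g | `[< exists2 p : uw, p \in uw_core & uw_elt p = g >]].

Lemma uw_elt_is_additive : zmod_morphism uw_elt.
Proof.
move=> p q /=.
have e : p = (p - q) + q by rewrite subrK.
by rewrite [in RHS]e -[_ + q]/(uw_add _ _) /= addrK.
Qed.

Lemma lin_part_closed : zmod_closed lin_part.
Proof.
split; first by apply/asboolP; exists 0; rewrite ?rpred0.
move=> _ _ /asboolP[p pC <-] /asboolP[q qC <-]; apply/asboolP.
by exists (p - q); rewrite ?rpredB // uw_elt_is_additive.
Qed.

HB.instance Definition _ :=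
  GRing.isZmodClosed.Build G lin_part lin_part_closed.

(* The order of l(G), inherited from uw; a relation between elements of G
   that only holds inside lin_part. *)
Definition lin_lt (a b : G) : Prop := exists p q : uw,
  [/\ p \in uw_core, q \in uw_core, uw_elt p = a, uw_elt q = b & uw_lt p q].

Record lin : Type := Lin { lin_val : G; _ : lin_val \in lin_part }.
HB.instance Definition _ := [isSub for lin_val].
HB.instance Definition _ := [Choice of lin by <:].
HB.instance Definition _ := [SubChoice_isSubZmodule of lin by <:].

Definition c_archimedean : Prop := forall g, g \in lin_part -> g = 0.

Definition proper_c_convex (H : {pred G}) : Prop :=
  [/\ {subset H <= lin_part}, convex lin_lt H & exists2 h, h \in H & h != 0].

Lemma uw_core_lt p q :
  p \in uw_core -> uw_elt q \notin lin_part -> uw_lt 0 q -> uw_lt p q.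
Proof.
move=> pC /asboolP qC q0.
have {}qC : q \notin uw_core by apply/negP => h; apply: qC; exists q.
have [|//|qp] := @lgo_total _ _ uw_ltP p q.
  by move=> pq; rewrite -pq pC in qC.
by move/negP: qC; case; exact: (uw_core_convex (rpred0 _) pC q0 qp).
Qed.

Lemma lin_part_cyc a b c h : h \in lin_part -> a - b \notin lin_part ->
  b - c \notin lin_part -> a - c \notin lin_part ->
  cyc a b c -> cyc a b (c + h).
Proof.
move=> /asboolP[t tC th].
wlog -> : a b c / a = 0.
  move=> W ab bc ac /(cyc_add (- a)) abc.
  have := W 0 (b - a) (c - a) erefl; rewrite !sub0r !opprB subrKA.
  move=> /(_ ab bc ac); rewrite -{1}(subrr a) => /(_ abc) /(cyc_add a).
  by rewrite add0r subrK addrAC subrK.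
rewrite !sub0r !rpredN => bL bcL cL bc.
have c0 : c <> 0 by move=> c0; rewrite c0 rpred0 in cL.
have b0 : b <> 0 by move=> b0; rewrite b0 rpred0 in bL.
pose C := Uw 0 c; pose B := Uw 0 b; pose P := C + t.
have P2 : uw_elt P = c + h by rewrite -th.
have NtC : - t \in uw_core by rewrite rpredN.
have P0 : uw_lt 0 P.
  have : uw_lt (- t) C by apply: uw_core_lt => //; right; split=> //; right; split.
  by move=> /(lgo_add uw_ltP t); rewrite addNr.
have Pz : uw_lt P uw_z.
  have : uw_lt t (uw_z - C).
    apply: uw_core_lt => //; first by rewrite uw_elt_is_additive sub0r rpredN.
    have : uw_lt C uw_z by left.
    by move=> /(lgo_add uw_ltP (- C)); rewrite subrr.
  by move=> /(lgo_add uw_ltP C); rewrite subrK addrC.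
have BP : uw_lt B P.
  have : uw_lt (- t) (C - B).
    apply: uw_core_lt => //.
      by rewrite uw_elt_is_additive /= -opprB rpredN.
    have : uw_lt B C by right; split=> //; left.
    by move=> /(lgo_add uw_ltP (- B)); rewrite subrr.
  move=> /(lgo_add uw_ltP (t + B)).
  by rewrite addKr addrA addrAC subrK.
have P1 : uw_int P = 0.
  case: P0 => [/= P0|[/= <-//]]; case: Pz => [/= Pz|[/= _ /lt00//]].
  by move: P0 Pz; lia.
case: BP => [|[_ ]]; first by rewrite P1.
by rewrite P2 => -[|[]].
Qed.

Definition quot_lin : Type := Quotient.quot lin_part.
HB.instance Definition _ := GRing.Zmodule.on quot_lin.

Definition lin_class (a : G) : quot_lin := \pi_(Quotient.quot lin_part)%qT a.

Definition quot_cyc (X Y Z : quot_lin) : Prop :=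
  [/\ X <> Y, Y <> Z, X <> Z & exists a b c : G,
    [/\ lin_class a = X, lin_class b = Y, lin_class c = Z & cyc a b c]].

Lemma lin_classP a b : lin_class a = lin_class b <-> a - b \in lin_part.
Proof.
rewrite Quotient.idealrBE; split=> [h|/eqP h //]; by apply/eqP.
Qed.

Lemma lin_class_surj (X : quot_lin) : exists a, lin_class a = X.
Proof. by exists (repr (X : Quotient.quot lin_part)); rewrite /lin_class reprK. Qed.

Lemma lin_class_is_additive : zmod_morphism lin_class.
Proof. exact: (@pi_is_zmod_morphism _ _ _ (Quotient.quot lin_part)). Qed.

Lemma quot_cycE a b c : lin_class a <> lin_class b ->
  lin_class b <> lin_class c -> lin_class a <> lin_class c ->
  quot_cyc (lin_class a) (lin_class b) (lin_class c) <-> cyc a b c.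
Proof.
move=> ab bc ac; split=> [[_ _ _ [a' [b' [c' [aa bb cc]]]]]|]; last first.
  by split=> //; exists a, b, c.
have step x y z z' : lin_class x <> lin_class y -> lin_class y <> lin_class z ->
    lin_class x <> lin_class z -> lin_class z = lin_class z' ->
    cyc x y z -> cyc x y z'.
  move=> /(contra_not (lin_classP _ _).2)/negP xy.
  move=> /(contra_not (lin_classP _ _).2)/negP yz.
  move=> /(contra_not (lin_classP _ _).2)/negP xz.
  move=> /esym/lin_classP zz /(lin_part_cyc zz xy yz xz).
  by rewrite addrCA subrr addr0.
rewrite -aa -bb -cc in ab bc ac.
move=> /(step _ _ _ _ ab bc ac cc) /cyc_rot; rewrite cc in bc ac.
move=> /(step _ _ _ _ bc (nesym ac) (nesym ab) aa) /cyc_rot.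
rewrite aa in ab ac.
by move=> /(step _ _ _ _ (nesym ac) ab (nesym bc) bb) /cyc_rot.
Qed.

Lemma quot_cyc_neq X Y Z : quot_cyc X Y Z -> [/\ X <> Y, Y <> Z & X <> Z].
Proof. by case. Qed.

Lemma quot_cyc_rot X Y Z : quot_cyc X Y Z -> quot_cyc Y Z X.
Proof.
move=> [XY YZ XZ [a [b [c [aX bY cZ /cyc_rot h]]]]].
by split; [|exact: nesym|exact: nesym|exists b, c, a].
Qed.

Lemma quot_cyc_trans C X Y Z : quot_cyc C X Y -> quot_cyc C Y Z -> quot_cyc C X Z.
Proof.
have [c <-] := lin_class_surj C; have [x <-] := lin_class_surj X.
have [y <-] := lin_class_surj Y; have [z <-] := lin_class_surj Z.
move=> cxy cyz; have [cx xy cy] := quot_cyc_neq cxy.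
have [_ yz cz] := quot_cyc_neq cyz.
move/(quot_cycE cx xy cy): cxy => cxy.
have [xz|xz] := pselect (lin_class x = lin_class z).
  rewrite -xz in cyz; move/(quot_cycE cy (nesym xy) cx): cyz.
  by move/(cyc_asym cxy).
move/(quot_cycE cy yz cz): cyz => /(cyc_trans cxy) h.
exact/(quot_cycE cx xz cz).
Qed.

Lemma quot_cyc_total C X Y : X <> C -> Y <> C -> X <> Y ->
  quot_cyc C X Y \/ quot_cyc C Y X.
Proof.
have [c <-] := lin_class_surj C; have [x <-] := lin_class_surj X.
have [y <-] := lin_class_surj Y => xc yc xy.
have xc' : x <> c by move=> e; apply: xc; rewrite e.
have yc' : y <> c by move=> e; apply: yc; rewrite e.
have xy' : x <> y by move=> e; apply: xy; rewrite e.
have [h|h] := cyc_total xc' yc' xy'.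
  by left; apply/(quot_cycE (nesym xc) xy (nesym yc)).
by right; apply/(quot_cycE (nesym yc) (nesym xy) (nesym xc)).
Qed.

Lemma quot_cyc_add X Y Z U :
  quot_cyc X Y Z -> quot_cyc (X + U) (Y + U) (Z + U).
Proof.
have [u <-] := lin_class_surj U.
move=> [XY YZ XZ [a [b [c [aX bY cZ h]]]]].
split; [by move/addIr|by move/addIr|by move/addIr|].
have D x y : lin_class (x + y) = lin_class x + lin_class y.
  by rewrite -[in RHS](addrK y x) lin_class_is_additive subrK.
by exists (a + u), (b + u), (c + u); rewrite !D aX bY cZ; split=> //; apply: cyc_add.
Qed.

HB.instance Definition _ := isCyclicallyOrdered.Build quot_lin
  quot_cyc_neq quot_cyc_rot quot_cyc_trans quot_cyc_total quot_cyc_add.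

End Unwound.

Definition lin_order (G : cycZmodType) (x y : lin G) : Prop :=
  lin_lt (lin_val x) (lin_val y).

Section Circle.
Variable R : realType.

Definition expi (t : R) : R[i] := Complex (cos t) (sin t).

Definition circle_cyc (x y z : R[i]) : Prop := exists t1 t2 t3 : R,
  [/\ 0 <= t1 < 2 * pi, 0 <= t2 < 2 * pi & 0 <= t3 < 2 * pi] /\
  [/\ x = expi t1, y = expi t2, z = expi t3 &
      [\/ t1 < t2 < t3, t2 < t3 < t1 | t3 < t1 < t2]].

Record circle_embedding (G : cycZmodType) (f : G -> R[i]) : Prop := {
  circle_norm : forall a, `|f a| = 1;
  circle_add : forall a b, f (a + b) = f a * f b;
  circle_inj : injective f;
  circle_cycE : forall a b c, cyc a b c <-> circle_cyc (f a) (f b) (f c) }.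

Definition n_divisible (n : nat) (A : zmodType) : Prop :=
  forall y : A, exists x, x *+ n = y.

(* The subgroup H is isomorphic to <zeta> = {zeta ^+ k}; natural exponents
   suffice since zeta has finite order. *)
Definition c_n_divisible (n : nat) (A : zmodType) : Prop :=
  n_divisible n A /\
  exists (H : zmodClosed A) (zeta : R[i]) (f : A -> R[i]),
    [/\ n.-primitive_root zeta,
        {in H &, forall a b, f (a + b) = f a * f b},
        {in H &, injective f} &
        forall z, (exists2 a, a \in H & f a = z) <-> exists k, z = zeta ^+ k].

End Circle.

(* R(x_1,...,x_m). *)
Definition cyc_seq (G : cycZmodType) (s : seq G) : Prop :=
  forall i j k, (i < j < k)%N -> (k < size s)%N -> cyc s`_i s`_j s`_k.

(* Only the values x 1, ..., x n of the sequence matter. *)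
Definition c_n_regular (n : nat) (G : cycZmodType) : Prop :=
  forall x : nat -> G,
    cyc_seq (0 :: [seq x i | i <- iota 1 n]) ->
  exists y : G,
    [\/ y *+ n = x 1%N, y *+ n = x n | cyc (x 1%N) (y *+ n) (x n)] /\
    cyc_seq (rcons [seq y *+ i | i <- iota 0 n] (x n)).

(* Main.v *)
(** Let [p] in [uw G] have integer part [uw_int p].  The limit [rotation p] of
    the means [uw_int (k p) / k] is a nondecreasing morphism [uw G -> R] that
    sends [z] to 1 and whose kernel is the greatest proper convex subgroup [C];
    [p |-> exp (2 i pi rotation p)] therefore embeds [K(G)] in the circle.

    (1) => (2): lift [x i] to [(0, x i)].
    (2) => (3): for [0 < c] in [C], apply c-regularity to the sequences
    [g + i c] (divisibility of [K(G)]) and [z - (n + 1 - i) c] (an element [Y]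
    with [n Y] congruent to [z] mod [C], whose image has order [n]).
    (3) => (4): a root of unity of order [n] in [K(G)] lifts to some [u] in [G]
    with [n u] in [l(G)], and regularity of [l(G)] allows to correct [u] by an
    element of [l(G)] so that [n u] falls into the given c-convex subgroup.
    (4) => (1): by Bezout, [z] is divisible by [n] modulo any nonzero convex
    [H] contained in [C], hence so is [uw G].  Given [x 1 < ... < x n], let [d]
    be [x n - x 1].  If some [e > 0] is infinitesimal with respect to [d],
    divide modulo the convex subgroup spanned by [e]; otherwise the convex
    subgroup spanned by [d] is archimedean and, according to whether it is
    discrete or dense, [x 1, ..., x n] are at least [n] points of a copy of Z,
    or a small [e] has a multiple of [n e] in every interval of length [d]. *)
Require Import Defs.
From HB Require Import structures.
From mathcomp Require Import all_boot all_order all_algebra.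
From mathcomp Require Import boolp classical_sets reals trigo.
From mathcomp Require Import complex.
From mathcomp Require Import zify ring lra.
Set Implicit Arguments.
Unset Strict Implicit.
Unset Printing Implicit Defensive.
Import Order.TTheory GRing.Theory Num.Theory.
Local Open Scope ring_scope.

(* Z (+) V, with V * V = 0, is a commutative ring containing V; through it
   [ring] decides the identities of an abelian group. *)
Section Idealization.
Variable V : zmodType.
Definition idealization : Type := (int * V)%type.
HB.instance Definition _ := GRing.Zmodule.on idealization.
Implicit Types u v w : idealization.
Definition ideal_mul u v : idealization := (u.1 * v.1, v.2 *~ u.1 + u.2 *~ v.1).
Definition ideal_one : idealization := (1, 0).

Lemma ideal_mulA : associative ideal_mul.
Proof.
move=> [a x] [b y] [c z]; congr pair => /=; first exact: mulrA.
by rewrite !mulrzDl -!mulrzA addrA [b * a]mulrC [c * a]mulrC.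
Qed.
Lemma ideal_mulC : commutative ideal_mul.
Proof. by move=> [a x] [b y]; congr pair => /=; [exact: mulrC|exact: addrC]. Qed.
Lemma ideal_mul1 : left_id ideal_one ideal_mul.
Proof. by move=> [a x]; rewrite /ideal_mul /= mul1r mul0rz addr0. Qed.
Lemma ideal_mulDl : left_distributive ideal_mul +%R.
Proof.
move=> [a x] [b y] [c z]; congr pair => /=; first exact: mulrDl.
by rewrite mulrzDl mulrzDr addrACA.
Qed.
Lemma ideal_one_neq0 : ideal_one != 0.
Proof. by []. Qed.
HB.instance Definition _ := GRing.Zmodule_isComNzRing.Build idealization
  ideal_mulA ideal_mulC ideal_mul1 ideal_mulDl ideal_one_neq0.

Definition to_ideal (v : V) : idealization := (0, v).
Lemma to_ideal_is_additive : zmod_morphism to_ideal.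
Proof. by move=> x y; congr pair; rewrite subrr. Qed.
HB.instance Definition _ := GRing.isZmodMorphism.Build V idealization to_ideal to_ideal_is_additive.
Lemma to_ideal_inj : injective to_ideal.
Proof. by move=> x y []. Qed.
End Idealization.
Ltac zmod := apply: to_ideal_inj; ring.


(** * Order of the unwound *)

Section UnwoundOrder.
Variable G : cycZmodType.
Implicit Types p q d : uw G.

Definition uw_le p q : Prop := p = q \/ uw_lt p q.

Lemma uw_leE p q : uw_le p q <-> 0 <= uw_int (q - p).
Proof.
split=> [[->|/uw_ltE[]//]|h]; first by rewrite subrr.
have [->|pq] := pselect (p = q); first by left.
by right; apply/uw_ltE; split=> // /esym.
Qed.

Lemma uw_lt_le p q : uw_lt p q -> uw_le p q.
Proof. by right. Qed.

Lemma uw_ltNge p q : uw_lt p q <-> ~ uw_le q p.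
Proof.
split=> [pq [qp|qp]|/not_orP[qp nqp]].
- by rewrite qp in pq; apply: (lgo_irr (uw_ltP G) pq).
- exact: (lgo_irr (uw_ltP G) (lgo_trans (uw_ltP G) pq qp)).
- by have [] := lgo_total (uw_ltP G) qp.
Qed.

Lemma uw_leNgt p q : uw_le p q <-> ~ uw_lt q p.
Proof. by rewrite uw_ltNge; split=> [? //|/contrapT]. Qed.

Lemma uw_ltB p q : uw_lt p q <-> uw_lt 0 (q - p).
Proof.
rewrite !uw_ltE subr0; split=> -[? h]; split=> // e; apply: h.
  exact/subr0_eq.
by rewrite e subrr.
Qed.

Lemma uw_leB p q : uw_le p q <-> uw_le 0 (q - p).
Proof. by rewrite !uw_leE subr0. Qed.

Lemma uw_lt_sub p q : uw_lt p q -> uw_lt 0 (q - p).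
Proof. by rewrite uw_ltB. Qed.

Lemma uw_le_sub p q : uw_le p q -> uw_le 0 (q - p).
Proof. by rewrite uw_leB. Qed.

Lemma uw_oppr_ge0 p : uw_le 0 (- p) <-> uw_le p 0.
Proof. by rewrite (uw_leB p) sub0r. Qed.

Lemma uw_intD p q : uw_int p + uw_int q <= uw_int (p + q) <= uw_int p + uw_int q + 1.
Proof. by rewrite /=; case: carry => /=; lia. Qed.

Lemma uw_intMn p k :
  uw_int p * k.+1%:Z <= uw_int (p *+ k.+1) < (uw_int p + 1) * k.+1%:Z.
Proof.
elim: k => [|k IH]; first by rewrite mulr1n; lia.
rewrite mulrSr; move: (uw_intD (p *+ k.+1) p) IH.
move: (uw_int _) (uw_int _) (uw_int p) => a b c.
have -> : k.+2%:Z = k.+1%:Z + 1 by lia.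
by rewrite !mulrDr !mulr1; lia.
Qed.

Lemma uw_le0D p q : uw_le 0 p -> uw_le 0 q -> uw_le 0 (p + q).
Proof. by rewrite !uw_leE !subr0; have := uw_intD p q; lia. Qed.

Lemma uw_lt0D p q : uw_lt 0 p -> uw_le 0 q -> uw_lt 0 (p + q).
Proof.
move=> p0 q0; have [e|//] := uw_le0D (uw_lt_le p0) q0.
have {}e : p = - q by rewrite -[p](addrK q) -e sub0r.
by case: ((uw_ltNge _ _).1 p0); apply/uw_leB; rewrite sub0r e opprK.
Qed.

Lemma uw_le0Mn p k : uw_le 0 p -> uw_le 0 (p *+ k).
Proof.
move=> p0; elim: k => [|k IH]; first by left.
by rewrite mulrSr; apply: uw_le0D.
Qed.

Lemma uw_lt0Mn p k : uw_lt 0 p -> uw_lt 0 (p *+ k.+1).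
Proof. by move=> p0; rewrite mulrS; apply: uw_lt0D => //; apply/uw_le0Mn/uw_lt_le. Qed.

Lemma uw_le_trans q p d : uw_le p q -> uw_le q d -> uw_le p d.
Proof.
move=> /uw_leB pq /uw_leB qd; apply/uw_leB.
have -> : d - p = (q - p) + (d - q) by zmod.
exact: uw_le0D.
Qed.

Lemma uw_lt_le_trans q p d : uw_lt p q -> uw_le q d -> uw_lt p d.
Proof.
move=> /uw_ltB pq /uw_leB qd; apply/uw_ltB.
have -> : d - p = (q - p) + (d - q) by zmod.
exact: uw_lt0D.
Qed.

Lemma uw_le_lt_trans q p d : uw_le p q -> uw_lt q d -> uw_lt p d.
Proof.
move=> /uw_leB pq /uw_ltB qd; apply/uw_ltB.
have -> : d - p = (d - q) + (q - p) by zmod.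
exact: uw_lt0D.
Qed.

Lemma uw_intZ (m : int) : uw_int (uw_z G *~ m) = m.
Proof.
suff H (k : nat) : uw_z G *+ k = Uw k%:Z 0.
  case: m => k; first by rewrite -pmulrn H.
  rewrite NegzE mulrNz -pmulrn H.
  suff -> : - (Uw k.+1%:Z 0 : uw G) = Uw (- k.+1%:Z) 0 by [].
  by apply/eqP; rewrite eq_sym -addr_eq0 uw_addZ addNr.
elim: k => // k IH; rewrite mulrSr IH uw_addZ; congr Uw; lia.
Qed.

Lemma uw_eltZ (m : int) : uw_elt (uw_z G *~ m) = 0.
Proof.
have e : {morph @uw_elt G : x y / x + y} by [].
have n x : uw_elt (- x) = - uw_elt x by [].
have H (k : nat) : uw_elt (uw_z G *+ k) = 0.
  by elim: k => // k IH; rewrite mulrSr e IH add0r.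
by case: m => k; rewrite ?NegzE ?mulrNz ?n -pmulrn H ?oppr0.
Qed.

(** The elements (m, 0) are the multiples of [uw_z G], so these multiples form the kernel of
    [uw_elt]. *)
Lemma uw_elt_eq p q : uw_elt p = uw_elt q ->
  p - q = uw_z G *~ uw_int (p - q).
Proof.
move=> pq; have : uw_elt (p - q) = 0 by rewrite uw_elt_is_additive pq subrr.
have := uw_intZ (uw_int (p - q)); have := uw_eltZ (uw_int (p - q)).
by case: (p - q) (uw_z G *~ _) => [i a] [j b] /= -> -> ->.
Qed.

Lemma uw_z_gt0 : uw_lt 0 (uw_z G).
Proof. by left. Qed.

End UnwoundOrder.
#[global] Hint Resolve uw_z_gt0 : core.
HB.instance Definition _ (G : cycZmodType) :=
  GRing.isZmodMorphism.Build (uw G) G (@uw_elt G) (@uw_elt_is_additive G).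

(** * Rotation number *)

Section RotationNumber.
Variables (R : realType) (G : cycZmodType).
Implicit Types p q : uw G.
Local Open Scope classical_set_scope.

Let slopes p : set R :=
  [set r | exists k : nat, r = (uw_int (p *+ k.+1))%:~R / k.+1%:R].

(** By [rotation_bounds], this supremum is within 1/k of the mean [uw_int (p *+ k) / k] for every k
    > 0, hence it is also the limit of the means. *)
Definition rotation p : R := sup (slopes p).

(** Both sides are compared with the integer part of [p *+ (j.+1 * k.+1)], bounded below and above
    by [uw_intMn]. *)
Lemma slopes_le p (j k : nat) :
  (uw_int (p *+ j.+1))%:~R / j.+1%:R <= ((uw_int (p *+ k.+1))%:~R + 1) / k.+1%:R :> R.
Proof.
rewrite ler_pdivrMr ?ltr0n // mulrAC ler_pdivlMr ?ltr0n //.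
rewrite -[1]/(1%:~R) -intrD -2![_.+1%:R]/(_.+1%:~R) -!intrM ler_int.
have := uw_intMn (p *+ j.+1) k; have := uw_intMn (p *+ k.+1) j.
by rewrite -!mulrnA mulnC; lia.
Qed.

Lemma rotation_bounds p k :
  (uw_int (p *+ k.+1))%:~R <= k.+1%:R * rotation p <= (uw_int (p *+ k.+1))%:~R + 1.
Proof.
have ub : ubound (slopes p) (((uw_int (p *+ k.+1))%:~R + 1) / k.+1%:R).
  by move=> _ [j ->]; apply: slopes_le.
apply/andP; split.
  rewrite mulrC -ler_pdivrMr ?ltr0n //; apply: ub_le_sup; last by exists k.
  by exists (((uw_int (p *+ k.+1))%:~R + 1) / k.+1%:R).
rewrite mulrC -ler_pdivlMr ?ltr0n //; apply: ge_sup => //.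
by exists ((uw_int (p *+ 1))%:~R / 1%:R), 0%N.
Qed.

Lemma eq0_of_bounded_multiples (r C : R) : (forall k, k.+1%:R * `|r| <= C) -> r = 0.
Proof.
move=> H; apply/eqP; apply: contraT; rewrite -normr_gt0 => r0.
have := archi_boundP (_ : 0 <= C / `|r|).
have C0 : 0 <= C by apply: le_trans (H 0%N); rewrite mul1r.
rewrite divr_ge0 // => /(_ isT); set k := Num.bound _.
rewrite ltr_pdivrMr // => h; have := H k; rewrite leNgt => /negP[].
by apply: lt_le_trans h _; rewrite ler_wpM2r // ler_nat.
Qed.

(** [uw_int] is additive up to one carry, and [k.+1 * rotation] is within 1 of it; so [k.+1] times
    the defect of additivity stays bounded as [k] grows. *)
Lemma rotationD p q : rotation (p + q) = rotation p + rotation q.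
Proof.
apply/eqP; rewrite -subr_eq0; apply/eqP.
apply: (@eq0_of_bounded_multiples _ 3) => k.
have := rotation_bounds p k; have := rotation_bounds q k; have := rotation_bounds (p + q) k.
rewrite mulrnDl; have /andP[] := uw_intD (p *+ k.+1) (q *+ k.+1).
rewrite -!(ler_int R) !intrD.
have k0 : 0 <= k.+1%:R :> R by [].
rewrite -[k.+1%:R](ger0_norm k0) -normrM ger0_norm // ler_norml !mulrBr !mulrDr.
lra.
Qed.

Lemma rotation_is_additive : zmod_morphism rotation.
Proof. by move=> p q; rewrite -[in RHS](subrK q p) [in RHS]rotationD addrK. Qed.

HB.instance Definition _ := GRing.isZmodMorphism.Build (uw G) R rotation rotation_is_additive.

Lemma le_rotation p q : uw_le p q -> rotation p <= rotation q.
Proof.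
move=> /uw_leE pq; rewrite -subr_ge0 -raddfB /=.
have /andP[+ _] := rotation_bounds (q - p) 0; rewrite mulr1n mul1r; apply: le_trans.
by rewrite ler0z.
Qed.

Lemma rotation_z : rotation (uw_z G) = 1.
Proof.
apply/eqP; rewrite -subr_eq0; apply/eqP.
apply: (@eq0_of_bounded_multiples _ 1) => k.
have := rotation_bounds (uw_z G) k.
rewrite -[uw_z G *+ _]/(uw_z G *~ k.+1%:Z) uw_intZ.
have k0 : 0 <= k.+1%:R :> R by [].
rewrite -[k.+1%:R in X in _ -> X](ger0_norm k0) -normrM ler_norml !mulrBr -pmulrn.
lra.
Qed.

Lemma rotation_zM (m : int) : rotation (uw_z G *~ m) = m%:~R.
Proof. by rewrite raddfMz /= rotation_z. Qed.

(** The kernel of [rotation] is a convex subgroup that misses [uw_z G], so the greatest proper one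
    contains it. Conversely, the multiples of an element of the core stay between [- z] and [z], so
    their rotations stay bounded. *)
Lemma rotation_core p : rotation p = 0 <-> p \in @uw_core G.
Proof.
pose K : {pred uw G} := [pred p | rotation p == 0].
split=> [p0|pC].
  apply: (@uw_core_max _ K); last by rewrite inE p0.
  - split=> [|x y]; rewrite !inE ?raddf0 // => /eqP x0 /eqP y0.
    by rewrite raddfB /= x0 y0 subrr.
  - move=> a b x; rewrite !inE => /eqP a0 /eqP b0 /uw_lt_le/le_rotation ax /uw_lt_le/le_rotation xb.
    by rewrite eq_le -{1}b0 xb -a0 ax.
  - by exists (uw_z G); rewrite inE rotation_z oner_eq0.
apply: (@eq0_of_bounded_multiples _ 2) => k.
have bnd q : q \in @uw_core G -> rotation q <= 1.
  move=> qC; rewrite -rotation_z; apply: le_rotation; apply/uw_leNgt => zq.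
  have := uw_core_proper G; rewrite (uw_core_convex (rpred0 _) qC _ zq) //.
rewrite -[k.+1%:R]ger0_norm // -normrM.
have -> : k.+1%:R * rotation p = rotation (p *+ k.+1) by rewrite raddfMn /= mulr_natl.
rewrite ler_norml.
have pk := rpredMn k.+1 pC; have := bnd _ pk.
have := bnd (- (p *+ k.+1)) (_ : _ \in _); rewrite rpredN => /(_ pk).
rewrite raddfN /=; lra.
Qed.

End RotationNumber.

(** * Regularity of the unwound *)

Section Regularity.
Variable G : cycZmodType.
Implicit Types p q d e h : uw G.

Lemma uw_leMn2 e a b : uw_le 0 e -> (a <= b)%N -> uw_le (e *+ a) (e *+ b).
Proof. by move=> e0 ab; apply/uw_leB; rewrite -mulrnBr //; apply: uw_le0Mn. Qed.

Definition uw_span e : {pred uw G} :=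
  [pred h | `[< exists k, uw_le h (e *+ k) /\ uw_le (- h) (e *+ k) >]].

Lemma uw_span_closed e : uw_le 0 e -> zmod_closed (uw_span e).
Proof.
move=> e0; split=> [|p q]; first by apply/asboolP; exists 0%N; rewrite oppr0; split; left.
move=> /asboolP[j [/uw_le_sub pj /uw_le_sub pj']] /asboolP[k [/uw_le_sub qk /uw_le_sub qk']].
apply/asboolP; exists (j + k)%N; split; apply/uw_leB.
  have -> : e *+ (j + k) - (p - q) = (e *+ j - p) + (e *+ k - - q) by zmod.
  exact: uw_le0D.
have -> : e *+ (j + k) - - (p - q) = (e *+ j - - p) + (e *+ k - q) by zmod.
exact: uw_le0D.
Qed.

Lemma uw_span_convex e : uw_le 0 e -> convex (@uw_lt G) (uw_span e).
Proof.
move=> e0 a b p /asboolP[j [_ aj]] /asboolP[k [bk _]] ap pb; apply/asboolP.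
exists (j + k)%N; split.
  apply: uw_le_trans (uw_lt_le pb) (uw_le_trans bk (uw_leMn2 e0 (leq_addl _ _))).
apply: uw_le_trans (uw_lt_le (lgo_opp (uw_ltP G) ap)) _.
exact: uw_le_trans aj (uw_leMn2 e0 (leq_addr _ _)).
Qed.

Lemma uw_span_self e : uw_le 0 e -> e \in uw_span e.
Proof.
move=> e0; apply/asboolP; exists 1%N; split; first by left.
by apply: (@uw_le_trans _ 0); rewrite ?mulr1n //; apply/uw_leB; rewrite sub0r opprK.
Qed.

(** Walking up from [- k e] in steps of [e], at most 2k + 1 steps are needed to pass [h]. *)
Lemma uw_span_floor e h : uw_lt 0 e -> h \in uw_span e ->
  exists j : int, uw_le (e *~ j) h /\ uw_lt h (e *~ (j + 1)).
Proof.
move=> e0 /asboolP[k [hk hk']].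
have : uw_le (e *~ (- k%:Z)) h.
  apply/uw_leB; have -> : h - e *~ (- k%:Z) = e *+ k - (- h) by zmod.
  exact: uw_le_sub.
have : uw_lt h (e *~ (- k%:Z + (k + k).+1%:Z)).
  apply: uw_le_lt_trans hk _; apply/uw_ltB.
  by have -> : e *~ (- k%:Z + (k + k).+1%:Z) - e *+ k = e by zmod.
elim: (k + k)%N (- k%:Z) => [|m IH] a hm ah; first by exists a.
have [|/uw_leNgt ah'] := pselect (uw_lt h (e *~ (a + 1))); first by exists a.
by apply: (IH (a + 1)) => //; rewrite -addrA -PoszD.
Qed.

(** If 0 < c < d, the double of c or that of d - c is at most d. Halving m times in this way fits
    2^m copies of an element below [e], and m <= 2^m. *)
Lemma exists_small e m : (forall d, uw_lt 0 d -> exists2 d', uw_lt 0 d' & uw_lt d' d) ->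
  uw_lt 0 e -> exists2 d, uw_lt 0 d & uw_le (d *+ m) e.
Proof.
move=> nomin e0.
have [d d0 de] : exists2 d, uw_lt 0 d & uw_le (d *+ 2 ^ m) e.
  elim: m => [|m [d d0 de]]; first by exists e => //; rewrite expn0 mulr1n; left.
  suff [c c0 cd] : exists2 c, uw_lt 0 c & uw_le (c *+ 2) d.
    exists c => //; apply: uw_le_trans de; rewrite expnS mulrnA.
    apply/uw_leB; rewrite -mulrnBl; apply: uw_le0Mn; exact: uw_le_sub.
  have [c c0 cd] := nomin d d0.
  have [cc|/uw_ltNge/uw_lt_sub/uw_lt_le cc] := pselect (uw_le (c *+ 2) d).
    by exists c.
  exists (d - c); first exact: uw_lt_sub.
  by apply/uw_leB; have -> : d - (d - c) *+ 2 = c *+ 2 - d by zmod.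
exists d => //; apply: uw_le_trans de; apply: uw_leMn2; last by rewrite ltnW // ltn_expl.
exact: uw_lt_le.
Qed.

Lemma uw_regular_of_divisible n : (2 <= n)%N ->
  (forall H : {pred uw G}, zmod_closed H -> convex (@uw_lt G) H ->
    {subset H <= @uw_core G} -> (exists2 e, e \in H & e != 0) ->
    forall p, exists y, p - y *+ n \in H) ->
  n_regular (@uw_lt G) n.
Proof.
move=> n2 D x _ xs.
have step i : (0 < i <= n)%N -> uw_le (x 1%N) (x i).
  elim: i => // -[_ _|i IH /andP[_ ilt]]; first by left.
  apply: (uw_le_trans (IH _)); first by rewrite (ltnW ilt).
  exact/uw_lt_le/xs.
have d0 : uw_lt 0 (x n - x 1%N).
  apply/uw_lt_sub; case: n n2 {D} xs step => // -[//|n] _ xs step.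
  by apply: uw_le_lt_trans (step n.+1 _) (xs _ _); rewrite ?leqnn ?leqnSn.
set d := x n - x 1%N in d0.
suff [y [y1 y2]] : exists y, uw_le 0 (y *+ n - x 1%N) /\ uw_le 0 (d - (y *+ n - x 1%N)).
  exists y; split; apply/uw_leB => //.
  by have -> : x n - y *+ n = d - (y *+ n - x 1%N) by rewrite /d; zmod.
have [[e e0 ed]|arch] := pselect (exists2 e, uw_lt 0 e & forall k, uw_le (e *+ k) d).
  have e0' := uw_lt_le e0.
  have en : e != 0 by apply/eqP => ee; rewrite ee in e0; case: (lgo_irr (uw_ltP G) e0).
  have dnot k : ~ uw_le d (e *+ k).
    move=> dk; have := uw_le_trans (ed k.+1) dk; move=> /uw_le_sub.
    have -> : e *+ k - e *+ k.+1 = 0 - e by zmod.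
    by move=> /(uw_leB e 0).2; apply/uw_ltNge.
  have De p : exists y, p - y *+ n \in uw_span e.
    apply: (D _ (uw_span_closed e0') (uw_span_convex e0')).
      apply: uw_core_max (uw_span_closed e0') (uw_span_convex e0') _.
      by exists d; apply/asboolP => -[k [/dnot]].
    by exists e => //; apply: uw_span_self.
  (* Up to multiples of [e], [q] is d/n and [y *+ n] is [x 1 + q]. As [q] exceeds every multiple of
     [e] and [q *+ 2 <= q *+ n], the margin left on either side of [x 1 + q] absorbs these
     errors. *)
  have [q /asboolP[j [/uw_le_sub qj /uw_le_sub qj']]] := De d.
  have [y /asboolP[k [/uw_le_sub yk /uw_le_sub yk']]] := De (x 1%N + q).
  have qbig m : uw_le 0 (q - e *+ m).
    apply/uw_le_sub/uw_leNgt => /uw_lt_le/uw_le_sub qm; apply: (dnot (m * n + j)%N).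
    apply/uw_leB; have -> : e *+ (m * n + j) - d =
        (e *+ m - q) *+ n + (e *+ j - (d - q *+ n)) by zmod.
    exact: uw_le0D (uw_le0Mn _ qm) qj.
  exists y; split.
    have -> : y *+ n - x 1%N = (q - e *+ k) + (e *+ k - (x 1%N + q - y *+ n)) by zmod.
    exact: uw_le0D.
  have q0 : uw_le 0 q by have := qbig 0%N; rewrite subr0.
  have qn : uw_le 0 (q *+ n - q *+ 2) by apply/uw_le_sub/uw_leMn2.
  have -> : d - (y *+ n - x 1%N) = (q - e *+ (j + k)) + (q *+ n - q *+ 2)
     + (e *+ j - - (d - q *+ n)) + (e *+ k - - (x 1%N + q - y *+ n)) by zmod.
  by do !apply: uw_le0D => //.
have {}arch e : uw_lt 0 e -> exists k, uw_le d (e *+ k).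
  move=> e0; apply: contrapT => /forallNP h; apply: arch; exists e => // k.
  by apply/uw_leNgt => /uw_lt_le; apply: h.
have d0' := uw_lt_le d0.
(* If the span of [d] is proper, it is contained in the core and [D] applies; if it is all of
   [uw G], there is nothing to divide. *)
have [y0 hd] : exists y, x 1%N - y *+ n \in uw_span d.
  have [full|/existsNP[q /negP qN]] := pselect (forall p, p \in uw_span d).
    by exists 0.
  have zc := uw_span_closed d0'; have cv := uw_span_convex d0'.
  apply: D => //; first by apply: uw_core_max => //; exists q.
  exists d; first exact: uw_span_self.
  by apply/eqP => ee; rewrite ee in d0; case: (lgo_irr (uw_ltP G) d0).
set h := x 1%N - y0 *+ n in hd.
have hspan e : uw_lt 0 e -> h \in uw_span e.
  move=> e0; have [k /uw_le_sub dk] := arch e e0; move: hd => /asboolP[m [/uw_le_sub h1 /uw_le_sub h2]].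
  apply/asboolP; exists (k * m)%N; split; apply/uw_leB.
    have -> : e *+ (k * m) - h = (e *+ k - d) *+ m + (d *+ m - h) by zmod.
    exact: uw_le0D (uw_le0Mn _ dk) h1.
  have -> : e *+ (k * m) - - h = (e *+ k - d) *+ m + (d *+ m - - h) by zmod.
  exact: uw_le0D (uw_le0Mn _ dk) h2.
(* Discrete case, where [e] is the least positive element, against dense case. *)
have [[e e0 emin]|nomin] :=
    pselect (exists2 e : uw G, uw_lt 0 e & forall c, uw_lt 0 c -> uw_le e c).
  have [j [/uw_le_sub jh /uw_lt_sub hj]] := uw_span_floor e0 (hspan e e0).
  have {jh hj} hE : h = e *~ j.
    case: jh => [/esym/subr0_eq //|/emin/uw_le_sub jh].
    case/uw_ltNge: hj; apply/uw_leB.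
    by have -> : 0 - (e *~ (j + 1) - h) = h - e *~ j - e by zmod.
  (* Consecutive points differ by at least [e], so [d] is at least (n - 1) e: the interval has room
     for every residue modulo n. *)
  have gap i : (0 < i <= n)%N -> uw_le 0 (x i - x 1%N - e *+ i.-1).
    elim: i => // -[_ _|i IH /andP[_ ilt]]; first by left; rewrite subrr subr0.
    have -> : x i.+2 - x 1%N - e *+ i.+1 = (x i.+2 - x i.+1 - e) + (x i.+1 - x 1%N - e *+ i) by zmod.
    apply: uw_le0D; last by apply: IH; rewrite (ltnW ilt).
    by apply/uw_le_sub/emin/uw_lt_sub/xs.
  (* [r] is the residue of [- j] modulo [n]. Since [h = e *~ j], the element x 1 + r e equals n y0 +
     (j + r) e, which is divisible by n. *)
  pose r : nat := `|((- j) %% n%:Z)%Z|%N.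
  have [rE rn] : j + r%:Z = n%:Z * - ((- j) %/ n%:Z)%Z /\ (r < n)%N.
    have n0 : n%:Z != 0 by lia.
    have := divz_eq (- j) n; have := modz_ge0 (- j) n0; have := ltz_mod (- j) n0.
    rewrite /r; set a := (_ %/ _)%Z; set b := (_ %% _)%Z => b1 b2 b3.
    split; last by lia.
    by rewrite gez0_abs // mulrN mulrC; lia.
  exists (y0 - e *~ ((- j) %/ n%:Z)%Z).
  have -> : (y0 - e *~ ((- j) %/ n%:Z)%Z) *+ n - x 1%N = e *+ r.
    have -> : e *+ r = e *~ (j + r%:Z) - h by rewrite hE; zmod.
    rewrite rE /h mulrzA; zmod.
  split; first by apply: uw_le0Mn; apply: uw_lt_le.
  have := gap n; rewrite leqnn (ltnW n2) => /(_ isT) gn.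
  have -> : d - e *+ r = (x n - x 1%N - e *+ n.-1) + e *+ (n.-1 - r).
    have -> : n.-1 = (r + (n.-1 - r))%N by lia.
    by rewrite addKn /d; zmod.
  by apply: uw_le0D => //; apply: uw_le0Mn; apply: uw_lt_le.
(* Dense case: as n e <= d, the first multiple of [e *+ n] above [h] exceeds [h] by at most [d]. *)
have [|e e0 /uw_le_sub ed] := @exists_small d n _ d0.
  move=> c c0; apply: contrapT => nc; apply: nomin; exists c => // c' c0'.
  by apply/uw_leNgt => cc; apply: nc; exists c'.
have E0 : uw_lt 0 (e *+ n) by rewrite -(prednK (ltnW n2)); apply: uw_lt0Mn.
have [j [/uw_le_sub jh /uw_lt_sub hj]] := uw_span_floor E0 (hspan _ E0).
exists (y0 + e *~ (j + 1)).
have -> : (y0 + e *~ (j + 1)) *+ n - x 1%N = e *+ n *~ (j + 1) - h by rewrite /h; zmod.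
split; first exact: uw_lt_le.
have -> : d - (e *+ n *~ (j + 1) - h) = (d - e *+ n) + (h - e *+ n *~ j) by zmod.
exact: uw_le0D.
Qed.

End Regularity.

(** * Cyclic regularity *)

Section CyclicRegularity.
Variable G : cycZmodType.
Implicit Types (p q d e h : uw G) (a b g : G).
Local Notation z := (uw_z G).
Local Notation core := (@uw_core G).

Lemma lt0_uw a b : lt0 a b <-> uw_lt (Uw 0 a) (Uw 0 b).
Proof. by split=> [?|[//|[]//]]; right. Qed.

(** The half-open interval from 0 to [z] is a copy of [G], on which the order of [uw G] is [lt0]. *)
Lemma uw_lift p : uw_le 0 p -> uw_lt p z -> p = Uw 0 (uw_elt p).
Proof.
rewrite uw_leE subr0; case: p => k a /= k0 [/= k1|[_ /lt00 //]].
by congr Uw; lia.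
Qed.

Lemma uw_lift_lt_z a : uw_lt (Uw 0 a) z.
Proof. by left. Qed.

Lemma cyc_seq_of_lt0 (s : seq G) :
  (forall i j, (i < j < size s)%N -> lt0 s`_i s`_j) -> cyc_seq s.
Proof.
move=> H i j k /andP[ij jk] ks; apply: cyc_of_lt0; apply: H; rewrite ?ks ?andbT //.
by rewrite ij (ltn_trans jk).
Qed.

(** [lt0 0 b] says that b is nonzero, which is read off a triple containing 0 and b. A sequence of
    two terms has no triple, hence the bound on the size. *)
Lemma lt0_of_cyc_seq (s : seq G) : s`_0 = 0 -> cyc_seq s -> (2 < size s)%N ->
  forall i j, (i < j < size s)%N -> lt0 s`_i s`_j.
Proof.
move=> s0 cs s2 [|i] [|j] // /andP[ij js]; last first.
  by left; have := cs 0%N i.+1 j.+1; rewrite s0; apply.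
right; split=> //; case: j ij js => [|j] _ js.
  by have := cs 0%N 1%N 2%N isT s2; rewrite s0 => /cyc_neq[/nesym].
by have := cs 0%N 1%N j.+2 isT js; rewrite s0 => /cyc_neq[_ _ /nesym].
Qed.

Lemma lt0_of_cyc a b g : cyc a b g -> lt0 a g -> lt0 a b /\ lt0 b g.
Proof.
move=> abg ag; have [ab bg _] := cyc_neq abg.
have [ab'|ba] := lt0_total ab; last first.
  by case: (cyc_asym abg); apply: cyc_rot; apply: cyc_of_lt0.
have [//|gb] := lt0_total bg.
by case: (cyc_asym abg); apply: cyc_of_lt0.
Qed.

Lemma size_multiples (y a : G) n : size (rcons [seq y *+ i | i <- iota 0 n] a) = n.+1.
Proof. by rewrite size_rcons size_map size_iota. Qed.

Lemma nth_multiples (y a : G) n i : (i < n)%N ->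
  (rcons [seq y *+ i | i <- iota 0 n] a)`_i = y *+ i.
Proof.
by move=> i_n; rewrite nth_rcons size_map size_iota i_n (nth_map 0%N) ?size_iota ?nth_iota.
Qed.

Lemma nth_multiples_last (y a : G) n :
  (rcons [seq y *+ i | i <- iota 0 n] a)`_n = a.
Proof. by rewrite nth_rcons size_map size_iota ltnn eqxx. Qed.

Lemma size_cons0_map (x : nat -> G) n : size (0 :: [seq x i | i <- iota 1 n]) = n.+1.
Proof. by rewrite /= size_map size_iota. Qed.

Lemma nth_cons0_map (x : nat -> G) n i : (0 < i <= n)%N ->
  (0 :: [seq x i | i <- iota 1 n])`_i = x i.
Proof. by case: i => //= i i_n; rewrite (nth_map 0%N) ?size_iota // nth_iota. Qed.

Lemma c_regular_of_regular n : (2 <= n)%N -> n_regular (@uw_lt G) n -> c_n_regular n G.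
Proof.
move=> n2 reg x; have ss := size_cons0_map x n; have sE i := @nth_cons0_map x n i.
set s := _ :: _ in ss sE * => cs.
have ls i j : (0 < i < j)%N -> (j <= n)%N -> lt0 (x i) (x j).
  move=> /andP[i0 ij] jn; have i_n := leq_trans (ltnW ij) jn.
  rewrite -!sE ?i0 ?(leq_trans _ ij) //.
  by apply: (lt0_of_cyc_seq _ cs); rewrite ?ss ?ij.
have ln0 : lt0 0 (x n).
  rewrite -(sE n) ?leqnn ?(ltnW n2) //.
  by apply: (@lt0_of_cyc_seq s _ cs _ 0%N n) => //; rewrite ss ltnS // leqnn ltnW.
have l10 : lt0 0 (x 1%N).
  rewrite -(sE 1%N) //; last exact: ltnW.
  by apply: (@lt0_of_cyc_seq s _ cs _ 0%N 1%N) => //; rewrite ss //= ltnS ltnW.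
have [||Y [/= Y1 Y2]] := reg (fun i => Uw 0 (x i)); first exact/lt0_uw.
  by move=> i /andP[i0 ilt]; apply/lt0_uw/ls; rewrite ?i0 /=.
have {}Y1 : uw_le (Uw 0 (x 1%N)) (Y *+ n) := Y1.
have {}Y2 : uw_le (Y *+ n) (Uw 0 (x n)) := Y2.
have Y0 : uw_lt 0 Y.
  apply/uw_ltNge => /uw_oppr_ge0 nY.
  have := uw_lt_le_trans ((lt0_uw _ _).1 l10) Y1 => /uw_ltNge; apply.
  by apply/uw_oppr_ge0; rewrite -mulNrn; apply: uw_le0Mn.
(* Up to k = n, the multiples of [Y] are at most (0, x n), hence below [z], so no carry occurs. *)
have kY k : (k <= n)%N -> Uw 0 (uw_elt Y *+ k) = Y *+ k.
  move=> kn; rewrite -raddfMn; apply/esym/uw_lift.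
    exact/uw_le0Mn/uw_lt_le.
  apply: uw_le_lt_trans (uw_lift_lt_z (x n)); apply: uw_le_trans Y2.
  by apply: uw_leMn2 => //; apply: uw_lt_le.
have ltY i j : (i < j <= n)%N -> lt0 (uw_elt Y *+ i) (uw_elt Y *+ j).
  move=> /andP[ij jn]; apply/lt0_uw; rewrite !kY // ?(leq_trans (ltnW ij)) //.
  by apply/uw_ltB; rewrite -mulrnBr ?(ltnW ij) // -(prednK (_ : 0 < j - i)%N) ?subn_gt0 //; apply: uw_lt0Mn.
exists (uw_elt Y); split.
  move: Y1 Y2; rewrite -kY // => -[[->]|/lt0_uw Y1]; first by constructor 1.
  move=> [[->]|/lt0_uw Y2]; first by constructor 2.
  by constructor 3; apply: cyc_of_lt0.
apply: cyc_seq_of_lt0 => i j; rewrite size_multiples ltnS => /andP[ij jn].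
rewrite nth_multiples ?(leq_trans ij jn) //.
move: (jn); rewrite leq_eqVlt => /orP[/eqP jE|jn']; last first.
  by rewrite nth_multiples //; apply: ltY; rewrite ij.
(* The last entry is [x n] instead of n y; it is reached through i y < n y <= x n. *)
rewrite jE nth_multiples_last; apply/lt0_uw.
apply: (@uw_lt_le_trans _ (Uw 0 (uw_elt Y *+ n))); last by rewrite kY.
by apply/lt0_uw/ltY; rewrite -{1}jE ij leqnn.
Qed.

(* [P] is [(0, n y)] for [Y = (0, y)]; it may differ from [Y *+ n] by a
   multiple of [z]. *)
Lemma c_regular_uw n : (2 <= n)%N -> c_n_regular n G ->
  forall X : nat -> uw G, uw_lt 0 (X 1%N) ->
    (forall i, (0 < i < n)%N -> uw_lt (X i) (X i.+1)) -> uw_lt (X n) z ->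
  exists Y P, [/\ uw_lt 0 Y, uw_lt (Y *+ n.-1) (X n), uw_elt P = uw_elt Y *+ n,
                  uw_le (X 1%N) P & uw_le P (X n)].
Proof.
move=> n2 reg X X0 Xs Xz.
have Xlt i j : (0 < i < j)%N -> (j <= n)%N -> uw_lt (X i) (X j).
  elim: j => [|j IH]; first by rewrite ltn0 andbF.
  move=> /andP[i0]; rewrite ltnS leq_eqVlt => /orP[/eqP<-|ij] jn.
    by apply: Xs; rewrite i0.
  apply: uw_lt_le_trans (IH _ (ltnW jn)) _; first by rewrite i0.
  by apply/uw_lt_le/Xs; rewrite (leq_trans i0 (ltnW ij)).
have XE i : (0 < i <= n)%N -> X i = Uw 0 (uw_elt (X i)).
  move=> /andP[i0 i_n]; apply: uw_lift.
    case: i i0 i_n => // -[_ _|i _ i_n]; first exact: uw_lt_le.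
    by apply/uw_lt_le/(uw_le_lt_trans (uw_lt_le X0))/Xlt.
  move: i_n; rewrite leq_eqVlt => /orP[/eqP-> //|i_n].
  by apply: lgo_trans (uw_ltP G) _ _ _ _ Xz; apply: Xlt; rewrite ?i0.
have lX i j : (0 < i < j)%N -> (j <= n)%N -> lt0 (uw_elt (X i)) (uw_elt (X j)).
  move=> /andP[i0 ij] jn; apply/lt0_uw.
  rewrite -!XE ?i0 ?(leq_trans i0 (ltnW ij)) ?(leq_trans (ltnW ij)) //.
  by apply: Xlt; rewrite ?i0.
have [|y [y1 cs]] := reg (fun i => uw_elt (X i)).
  have sE i := @nth_cons0_map (fun i => uw_elt (X i)) n i.
  apply: cyc_seq_of_lt0 => i j; rewrite size_cons0_map ltnS => /andP[ij jn].
  rewrite (sE j) ?jn ?(leq_ltn_trans _ ij) //; case: i ij => [|i] ij.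
    apply/lt0_uw; rewrite -XE ?ij //.
    case: j ij jn => // -[_ _ //|j _ jn].
    by apply: (lgo_trans (uw_ltP G) X0); apply: Xlt.
  by rewrite sE ?(leq_trans (ltnW ij) jn) //; apply: lX.
have ss := size_multiples y (uw_elt (X n)) n.
have sE i := @nth_multiples y (uw_elt (X n)) n i.
have sn := nth_multiples_last y (uw_elt (X n)) n.
set s := rcons _ _ in cs ss sE sn.
have ls i j : (i < j <= n)%N -> lt0 s`_i s`_j.
  move=> ij; apply: (lt0_of_cyc_seq _ cs); rewrite ?ss //.
  by rewrite sE ?mulr0n // (ltnW n2).
(* The terms 0, y, ..., (n - 1) y increase for [lt0], so adding [y] causes no carry before the n-th
   multiple, about which the sequence says nothing. *)
have kY k : (k < n)%N -> (Uw 0 y : uw G) *+ k = Uw 0 (y *+ k).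
  elim: k => // k IH kn; rewrite mulrSr IH ?(ltnW kn) // -[_ + _]/(uw_add _ _).
  rewrite /uw_add /= -mulrSr /carry -mulrSr; congr Uw.
  rewrite asboolF ?addr0 //; apply: lt0_nge.
  by rewrite -!sE ?(ltnW kn) //; apply: ls; rewrite leqnn ltnW.
exists (Uw 0 y), (Uw 0 (y *+ n)).
have n0 : (0 < n)%N by exact: ltnW.
have y0 : lt0 0 y.
  by have := ls 0%N 1%N; rewrite !sE // mulr0n mulr1n; apply; apply: ltnW.
split=> //.
- exact/lt0_uw.
- rewrite kY ?prednK // XE ?n0 ?leqnn //; apply/lt0_uw.
  by rewrite -sn -sE ?prednK //; apply: ls; rewrite prednK // leqnn.
- rewrite XE //; case: y1 => [->|->|/= y1]; first by left.
    by apply/uw_lt_le/lt0_uw/lX.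
  by have [/lt0_uw/uw_lt_le] := lt0_of_cyc y1 (lX 1%N n n2 (leqnn n)).
- rewrite (XE n) ?n0 ?leqnn //; case: y1 => [->|->|/= y1]; last 2 first.
  + by left.
  + by have [_ /lt0_uw/uw_lt_le] := lt0_of_cyc y1 (lX 1%N n n2 (leqnn n)).
  by apply/uw_lt_le/lt0_uw/lX.
Qed.

End CyclicRegularity.

(** * Consequences of c-regularity for l(G) and K(G) *)

Section LinearPart.
Variable G : cycZmodType.
Implicit Types (p q d e h : uw G) (a b g : G).
Local Notation z := (uw_z G).
Local Notation core := (@uw_core G).
Local Notation lpart := (@lin_part G).

Lemma uw_core_le d e p : d \in core -> e \in core -> uw_le d p -> uw_le p e -> p \in core.
Proof.
move=> dC eC [<- //|dp] [-> //|pe]; exact: uw_core_convex dC eC dp pe.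
Qed.

Lemma uw_core_lt_z p : p \in core -> uw_lt p z.
Proof.
move=> pC; apply/uw_ltNge => zp; have /negP[] := uw_core_proper G.
exact: uw_core_le (rpred0 _) pC (uw_lt_le (uw_z_gt0 G)) zp.
Qed.

(** Two such elements differ by a multiple of [z], and the core, lying strictly below [z], contains
    no multiple of [z] but 0. So the core is order-isomorphic to l(G). *)
Lemma uw_core_inj p q : p \in core -> q \in core -> uw_elt p = uw_elt q -> p = q.
Proof.
move=> pC qC pq; apply/subr0_eq; have e := uw_elt_eq pq.
have bnd (k : int) : z *~ k \in core -> k <= 0.
  move=> /uw_core_lt_z; rewrite /uw_lt uw_intZ uw_eltZ => -[/= k1|[_ /lt00 //]].
  by lia.
have := bnd (uw_int (p - q)); rewrite -e rpredB // => /(_ isT) k1.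
have := bnd (- uw_int (p - q)); rewrite mulrNz -e rpredN rpredB // => /(_ isT) k2.
by rewrite e; have -> : uw_int (p - q) = 0 by lia.
Qed.

Lemma lin_ltE p q : p \in core -> q \in core ->
  lin_lt (uw_elt p) (uw_elt q) <-> uw_lt p q.
Proof.
move=> pC qC; split=> [[p' [q' [p'C q'C pp qq]]]|pq]; last by exists p, q.
by rewrite (uw_core_inj p'C pC pp) (uw_core_inj q'C qC qq).
Qed.

Lemma uw_elt_core p : p \in core -> uw_elt p \in lpart.
Proof. by move=> pC; apply/asboolP; exists p. Qed.

Section Consequences.
Variable n : nat.
Hypotheses (n2 : (2 <= n)%N) (reg : c_n_regular n G).

(** Lift the [x i] to the core. The [Y] of [c_regular_uw] is in the core because 0 < Y <= (n - 1) Y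
    < X n; so is [P], and two core elements with the same image coincide, whence P = n Y. *)
Lemma c_regular_lin_part : n_regular (@lin_order G) n.
Proof.
move=> x x0 xs.
have lift i : exists p, p \in core /\ uw_elt p = lin_val (x i).
  by have /asboolP[p pC pE] := valP (x i); exists p.
have [X XP] := choice lift.
have XC i : X i \in core by have [] := XP i.
have XE i : uw_elt (X i) = lin_val (x i) by have [] := XP i.
have [|i iP||Y [P [Y0 Yn PE P1 P2]]] := c_regular_uw n2 reg (X := X).
- by apply/lin_ltE; rewrite ?rpred0 // XE; exact: x0.
- by apply/lin_ltE => //; rewrite !XE; exact: xs.
- exact: uw_core_lt_z.
have Y0' := uw_lt_le Y0.
have YC : Y \in core.
  apply: (uw_core_le (rpred0 _) (XC n) Y0' (uw_le_trans _ (uw_lt_le Yn))).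
  have n1 : (1 <= n.-1)%N by lia.
  exact: uw_leMn2 Y0' n1.
have PC := uw_core_le (XC 1%N) (XC n) P1 P2.
have PY : P = Y *+ n by apply: uw_core_inj; rewrite ?rpredMn // PE raddfMn.
exists (Lin (uw_elt_core YC)).
have yn : lin_val (Lin (uw_elt_core YC) *+ n) = uw_elt (Y *+ n).
  by rewrite -[lin_val _]/(val _) !raddfMn.
have YnC : Y *+ n \in core by rewrite rpredMn.
rewrite PY in P1 P2; split.
  case: P1 => [P1|P1]; [left|right].
    by apply: val_inj; rewrite /= yn -XE P1.
  by rewrite /lin_order yn -XE; apply/lin_ltE.
case: P2 => [P2|P2]; [left|right].
  by apply: val_inj; rewrite /= yn -XE P2.
by rewrite /lin_order yn -XE; apply/lin_ltE.
Qed.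

Variable c : uw G.
Hypotheses (cC : c \in core) (c0 : uw_lt 0 c).

Lemma c_regular_quot_divisible g : exists y, y *+ n - g \in lpart.
Proof.
(* Outside l(G), the difference between [z] and (0, g) exceeds the whole core, so all the points g +
   i c stay below [z]. *)
have [gL|gL] := boolP (g \in lpart); first by exists 0; rewrite mul0rn sub0r rpredN.
have c0' := uw_lt_le c0.
have g0 : uw_lt 0 (Uw 0 g : uw G).
  by apply/lt0_uw; right; split=> // g0; rewrite g0 rpred0 in gL.
have [|||Y [P [_ _ PE P1 P2]]] := c_regular_uw n2 reg (X := fun i => Uw 0 g + c *+ i).
- by apply: uw_lt0D => //; apply: uw_le0Mn.
- move=> i _; apply/uw_ltB; have -> : Uw 0 g + c *+ i.+1 - (Uw 0 g + c *+ i) = c by zmod.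
  by [].
- apply/uw_ltB; have -> : z - (Uw 0 g + c *+ n) = (z - Uw 0 g) - c *+ n by zmod.
  apply/uw_lt_sub/uw_core_lt; first by rewrite rpredMn.
    by rewrite raddfB /= sub0r rpredN.
  exact/uw_lt_sub/uw_lift_lt_z.
exists (uw_elt Y); rewrite -PE.
have -> : uw_elt P - g = uw_elt (P - Uw 0 g) by rewrite raddfB.
apply: uw_elt_core; apply: (@uw_core_le c (c *+ n)); rewrite ?rpredMn //.
  apply/uw_leB; have -> : P - Uw 0 g - c = P - (Uw 0 g + c *+ 1) by zmod.
  exact: (uw_le_sub P1).
apply/uw_leB; have -> : c *+ n - (P - Uw 0 g) = Uw 0 g + c *+ n - P by zmod.
  exact: (uw_le_sub P2).
Qed.

(** [P] lies between z - n c and z - c, and n Y differs from it by a multiple k z. What remains is k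
    = 0. *)
Lemma c_regular_root : exists Y, Y *+ n - z \in core.
Proof.
case: n n2 reg => // -[//|m] n2' reg'.
have c0' := uw_lt_le c0.
have cz k : uw_lt 0 (z - c *+ k) by apply/uw_lt_sub/uw_core_lt_z; rewrite rpredMn.
have [|||Y [P [Y0 Yn PE P1 P2]]] :=
    c_regular_uw n2' reg' (X := fun i => z - c *+ (m.+3 - i)).
- exact: cz.
- move=> i /andP[_ im].
  have [k -> ->] : exists2 k, (m.+3 - i = k.+1)%N & (m.+3 - i.+1 = k)%N.
    by exists (m.+2 - i)%N; lia.
  by apply/uw_ltB; have -> : z - c *+ k - (z - c *+ k.+1) = c by zmod.
- apply/uw_ltB; have -> k : z - (z - c *+ k) = c *+ k by zmod.
  by rewrite subSnn.
rewrite subSnn in P2 Yn; rewrite subSS subn0 in P1.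
have nY : Y *+ m.+2 - P = z *~ uw_int (Y *+ m.+2 - P).
  by apply: uw_elt_eq; rewrite PE raddfMn.
move: (uw_int _) nY => k nY.
have ltP' : uw_lt P z.
  by apply: uw_le_lt_trans P2 _; apply/uw_ltB; have -> : z - (z - c *+ 1) = c by zmod.
exists Y; suff k0 : k = 0.
  have -> : Y *+ m.+2 - z = P - z by move: nY; rewrite k0 => /subr0_eq ->.
  apply: (@uw_core_le (- (c *+ m.+2)) 0); rewrite ?rpredN ?rpred0 ?rpredMn //.
    apply/uw_leB; have -> : P - z - - (c *+ m.+2) = P - (z - c *+ m.+2) by zmod.
  exact: (uw_le_sub P1).
  by apply/uw_leB; rewrite sub0r opprB; exact/uw_le_sub/uw_lt_le.
have lt_int (j : int) : uw_lt 0 (z *~ j) -> 0 < j.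
  by rewrite /uw_lt uw_intZ uw_eltZ => -[//|[_ /lt00]].
have k0 : 0 <= k.
  suff : 0 < k + 1 by lia.
  apply: lt_int; have -> : z *~ (k + 1) = (z - P) + Y *+ m.+2.
    by rewrite mulrzDr -nY; zmod.
  by apply: uw_lt0D; [exact: uw_lt_sub|exact/uw_le0Mn/uw_lt_le].
(* Up to the core, n Y would be at least 2 z, whereas (n - 1) Y < z - c. For n = 2 these agree
   modulo the core, and the exact terms in [c] and the strict inequality decide. *)
have k1 : ~ 1 <= k.
  move=> k1; have A := uw_lt_sub Yn.
  have B := uw_le_sub P1.
  have C : uw_le 0 (z *~ (k - 1)).
    by rewrite uw_leE subr0 uw_intZ; lia.
  (* With n = m + 2: n A > 0, (n - 1) B >= 0 and (n - 1) C >= 0 add up to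
     - m (z - n c) <= 0. *)
  have := uw_le0Mn m (uw_lt_le (cz m.+2)); apply/uw_ltNge.
  have -> : (z - c *+ m.+2) *+ m = - ((z - c *+ 1 - Y *+ m.+1) *+ m.+2 +
     ((P - (z - c *+ m.+2)) *+ m.+1 + (z *~ (k - 1)) *+ m.+1)).
    have -> : z *~ (k - 1) = Y *+ m.+2 - P - z by rewrite nY; zmod.
    zmod.
  apply/uw_ltNge => /uw_oppr_ge0; apply/uw_ltNge.
  apply: uw_lt0D; first exact: uw_lt0Mn.
  by apply: uw_le0D; apply: uw_le0Mn.
by lia.
Qed.

End Consequences.
End LinearPart.

(** * Embedding of K(G) in the circle *)

Section Expi.
Variable R : realType.
Implicit Types (s t : R).

Lemma expiD s t : expi (s + t) = expi s * expi t.
Proof.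
rewrite /expi cosD sinD; apply/eqP; rewrite eq_complex /= eqxx /=.
by rewrite addrC.
Qed.

Lemma expi0 : expi (0 : R) = 1.
Proof. by rewrite /expi cos0 sin0. Qed.

Lemma expi_eq0 s : expi s != 0.
Proof.
apply/eqP => s0; have : expi s * expi (- s) = 1 by rewrite -expiD subrr expi0.
by move/eqP; rewrite s0 mul0r eq_sym oner_eq0.
Qed.

Lemma norm_expi s : `|expi s| = 1.
Proof. by rewrite normc_def /= cos2Dsin2 sqrtr1. Qed.

Lemma expi_int (k : int) : expi (2 * pi * k%:~R) = 1 :> R[i].
Proof.
have E (m : nat) : expi (2 * pi * m%:R) = 1 :> R[i].
  elim: m => [|m IH]; first by rewrite mulr0 expi0.
  rewrite -[m.+1%:R]natr1 mulrDr mulr1 expiD IH mul1r /expi.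
  by rewrite mulr_natl cos2pi sin2pi.
case: k => m; first exact: E.
rewrite NegzE mulrNz mulrN; apply: (mulIf (expi_eq0 (2 * pi * m.+1%:R))).
by rewrite -expiD addNr expi0 E mul1r.
Qed.

(** On the fractional part r of t, 1 - cos (2 pi r) is twice the square of sin (pi r), which is
    positive for 0 < r < 1. *)
Lemma expi_eq1 t : expi (2 * pi * t) = 1 -> exists k : int, t = k%:~R.
Proof.
move=> t1; exists (Num.floor t); have /andP[f1 f2] := floor_itv t.
set k := Num.floor t in f1 f2 *; pose r := t - k%:~R.
have r1 : expi (2 * pi * r) = 1.
  by rewrite /r mulrBr -mulrN -mulrNz expiD t1 expi_int mulr1.
have r0 : 0 <= r < 1 by move: f2; rewrite /r intrD mulr1z => f2; apply/andP; split; lra.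
have pi0 := pi_gt0 R.
have [/eqP|rp] := eqVneq r 0; first by rewrite subr_eq0 => /eqP.
have rgt : 0 < r by rewrite lt_def rp; case/andP: r0.
have sr : 0 < sin (pi * r).
  apply: sin_gt0_pi; rewrite mulr_gt0 //= gtr_pMr //; by case/andP: r0.
move: r1; rewrite /expi => -[+ _].
rewrite -mulrA mulr_natl cos_mulr2n cos2sin2 => h.
have : sin (pi * r) ^+ 2 = 0 by lra.
by move/eqP; rewrite sqrf_eq0 (gt_eqF sr).
Qed.

Lemma expi_inj s t : 0 <= s < 2 * pi -> 0 <= t < 2 * pi -> expi s = expi t -> s = t.
Proof.
move=> /andP[s0 s1] /andP[t0 t1] st; have pi0 := pi_gt0 R.
have e : s - t = 2 * pi * ((s - t) / (2 * pi)).
  by rewrite mulrC divfK // mulf_neq0 ?pnatr_eq0 // gt_eqF.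
have [|k kE] := @expi_eq1 ((s - t) / (2 * pi)).
  by rewrite -e expiD st -expiD subrr expi0.
have {}e : s - t = 2 * pi * k%:~R by rewrite {1}e kE.
suff k0 : k = 0 by apply/eqP; rewrite -subr_eq0 e k0 mulr0.
have [k1|k1|//] := ltgtP k 0.
  have : 2 * pi * k%:~R <= 2 * pi * (-1) :> R.
    by rewrite ler_pM2l ?mulr_gt0 // -[-1]/((-1)%:~R) ler_int; lia.
  by rewrite -e mulrN1 => h; exfalso; lra.
have : 2 * pi * 1 <= 2 * pi * k%:~R :> R.
  by rewrite ler_pM2l ?mulr_gt0 // -[1]/(1%:~R) ler_int; lia.
by rewrite -e mulr1 => h; exfalso; lra.
Qed.

End Expi.

(** Cutting at 0 gives the same three alternatives as in [circle_cyc], which reduces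
    [quot_circle_cycE] to the comparison of [lt0] with the order of the angles. *)
Lemma cyc_lt0E (G : cycZmodType) (a b c : G) :
  cyc a b c <-> [\/ lt0 a b /\ lt0 b c, lt0 b c /\ lt0 c a | lt0 c a /\ lt0 a b].
Proof.
split=> [abc|]; last first.
  case=> -[h1 h2]; first exact: cyc_of_lt0.
    by apply: cyc_rot; apply: cyc_rot; apply: cyc_of_lt0.
  by apply: cyc_rot; apply: cyc_of_lt0.
have [ab bc ac] := cyc_neq abc.
have [h1|h1] := lt0_total ab; have [h2|h2] := lt0_total bc; have [h3|h3] := lt0_total ac;
  by [constructor 1|constructor 2|constructor 3|
      case: (cyc_asym abc); apply: cyc_of_lt0|
      case: (cyc_asym abc); apply/cyc_rot/cyc_of_lt0|
      case: (cyc_asym abc); apply/cyc_rot/cyc_rot/cyc_of_lt0].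
Qed.

Section CircleEmbedding.
Variables (R : realType) (G : cycZmodType).
Implicit Types (p q : uw G) (a b g : G) (X Y : quot_lin G).
Local Notation z := (uw_z G).
Local Notation rot := (rotation R).

HB.instance Definition _ := GRing.isZmodMorphism.Build G (quot_lin G)
  (@lin_class G) (@lin_class_is_additive G).

(** The preimage of l(G) in [uw G] is the sum of the kernel of [rot] and of the multiples of [z],
    where [rot] takes its integer values. *)
Lemma lin_part_rot p : uw_elt p \in @lin_part G <-> exists k : int, rot p = k%:~R.
Proof.
split=> [/asboolP[q qC qp]|[k kE]]; last first.
  have -> : uw_elt p = uw_elt (p - z *~ k) by rewrite raddfB /= uw_eltZ subr0.
  by apply/uw_elt_core/(rotation_core R); rewrite raddfB /= rotation_zM kE subrr.
exists (uw_int (p - q)); rewrite -(rotation_zM R G) -uw_elt_eq // raddfB /=.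
by rewrite ((rotation_core R q).2 qC) subr0.
Qed.

Definition uw_circle p : R[i] := expi (2 * pi * rot p).

Lemma uw_circleD p q : uw_circle (p + q) = uw_circle p * uw_circle q.
Proof. by rewrite /uw_circle rotationD mulrDr expiD. Qed.

Lemma uw_circleX p k : uw_circle (p *+ k) = uw_circle p ^+ k.
Proof.
elim: k => [|k IH]; first by rewrite /uw_circle raddf0 mulr0 expi0.
by rewrite mulrSr uw_circleD IH exprSr.
Qed.

Lemma uw_circle_eq1 p : uw_circle p = 1 <-> uw_elt p \in @lin_part G.
Proof.
rewrite lin_part_rot; split=> [/expi_eq1 //|[k kE]].
by rewrite /uw_circle kE expi_int.
Qed.

Lemma uw_circle_eq p q :
  uw_circle p = uw_circle q <-> lin_class (uw_elt p) = lin_class (uw_elt q).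
Proof.
rewrite lin_classP -[uw_elt p - uw_elt q]/(uw_elt p - uw_elt q) -raddfB -uw_circle_eq1.
rewrite -{1}[p](subrK q) uw_circleD; split=> [|->]; last by rewrite mul1r.
by rewrite -{2}[uw_circle q]mul1r => /(mulIf (expi_eq0 _)).
Qed.

Definition quot_circle X : R[i] :=
  uw_circle (Uw 0 (repr (X : Quotient.quot (@lin_part G)))).

Lemma quot_circleE p : quot_circle (lin_class (uw_elt p)) = uw_circle p.
Proof. by apply/uw_circle_eq; rewrite /= /lin_class reprK. Qed.

Lemma quot_circle_inj : injective quot_circle.
Proof.
move=> X Y; have [a <-] := lin_class_surj X; have [b <-] := lin_class_surj Y.
rewrite -[a]/(uw_elt (Uw 0 a)) -[b]/(uw_elt (Uw 0 b)) !quot_circleE.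
by move/uw_circle_eq.
Qed.

Lemma quot_circleD X Y : quot_circle (X + Y) = quot_circle X * quot_circle Y.
Proof.
have [a <-] := lin_class_surj X; have [b <-] := lin_class_surj Y.
rewrite -[a]/(uw_elt (Uw 0 a)) -[b]/(uw_elt (Uw 0 b)) -raddfD -[_ + _]/(uw_elt (Uw 0 a + Uw 0 b)).
by rewrite !quot_circleE uw_circleD.
Qed.

(** The argument of [quot_circle X], with a full turn as unit. Reduction modulo 1 matters for the
    class 0: a negative element of l(G) has its lift just below [z], with rotation 1. *)
Definition turn X : R :=
  let t := rot (Uw 0 (repr (X : Quotient.quot (@lin_part G)))) in t - (Num.floor t)%:~R.

Lemma turn_itv X : 0 <= turn X < 1.
Proof.
rewrite /turn; have /andP[f1 f2] := floor_itv (rot (Uw 0 (repr (X : Quotient.quot (@lin_part G))))).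
by move: f2; rewrite intrD mulr1z => f2; apply/andP; split; lra.
Qed.

Lemma quot_circle_turn X : quot_circle X = expi (2 * pi * turn X).
Proof. by rewrite /turn mulrBr -mulrN -mulrNz expiD expi_int mulr1. Qed.

Lemma turn_inj : injective turn.
Proof. by move=> X Y XY; apply: quot_circle_inj; rewrite !quot_circle_turn XY. Qed.

Lemma turn0 : turn 0 = 0.
Proof.
have : quot_circle 0 = 1.
  have -> : 0 = lin_class (uw_elt (0 : uw G)) by rewrite !raddf0.
  by rewrite quot_circleE /uw_circle raddf0 mulr0 expi0.
rewrite quot_circle_turn => /expi_eq1[k kE]; rewrite kE.
have := turn_itv 0; rewrite kE ler0z -[1]/(1%:~R) ltr_int => k0.
by have -> : k = 0 by lia.
Qed.

Lemma turn_lt X Y : lt0 X Y -> turn X < turn Y.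
Proof.
move=> XY; rewrite lt_neqAle; apply/andP; split.
  by apply/eqP => /turn_inj e; rewrite e in XY; apply: lt0_irr XY.
case: XY => [XY|[-> _]]; last by rewrite turn0; case/andP: (turn_itv Y).
have [X0 XnY Y0] := cyc_neq XY; have ta := turn_itv X.
move: XY X0 XnY Y0 ta; rewrite /turn.
set x := repr _; set y := repr _.
have <- : lin_class x = X by rewrite /lin_class reprK.
have <- : lin_class y = Y by rewrite /lin_class reprK.
rewrite -(raddf0 (@lin_class G)) => XY X0 XnY Y0 ta.
(* Rotation 1 would put [g] in l(G); so on the nonzero classes [turn] is the rotation itself, which
   is monotone. *)
have bnd (g : G) : lin_class (0 : G) <> lin_class g -> Num.floor (rot (Uw 0 g)) = 0.
  move=> g0.
  have b0 : 0 <= rot (Uw 0 g).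
    by rewrite -(raddf0 (@rotation R G)); apply: le_rotation; apply/uw_leE; rewrite subr0.
  have b1 : rot (Uw 0 g) <= 1.
    by rewrite -(rotation_z R G); apply/le_rotation/uw_lt_le/uw_lift_lt_z.
  apply: floor_def; rewrite b0 /= add0r lt_neqAle b1 andbT.
  apply/eqP => r1; apply: g0; apply/esym/lin_classP; rewrite subr0.
  by apply/(lin_part_rot (Uw 0 g)); exists 1.
rewrite !bnd ?subr0 //.
apply/le_rotation/uw_lt_le/lt0_uw; left.
by apply/(quot_cycE X0 XnY) => //.
Qed.

Lemma turn_ltE X Y : turn X < turn Y <-> lt0 X Y.
Proof.
split=> [XY|/turn_lt //].
have [|//|/turn_lt] := @lt0_total _ X Y.
  by move=> e; rewrite e ltxx in XY.
by rewrite ltNge (ltW XY).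
Qed.

Lemma quot_circle_cycE X Y Z : cyc X Y Z <->
  circle_cyc (quot_circle X) (quot_circle Y) (quot_circle Z).
Proof.
have pi0 := pi_gt0 R.
have itv W : 0 <= 2 * pi * turn W < 2 * pi.
  have /andP[w0 w1] := turn_itv W.
  by rewrite gtr_pMr ?w1 ?mulr_ge0 ?mulr_gt0 // ltW.
have mono V W : (2 * pi * turn V < 2 * pi * turn W) = (turn V < turn W).
  by rewrite ltr_pM2l // mulr_gt0.
have ltE V W : lt0 V W = (turn V < turn W) :> Prop.
  by apply/propext; rewrite turn_ltE.
rewrite cyc_lt0E !ltE; split=> [h|].
  exists (2 * pi * turn X), (2 * pi * turn Y), (2 * pi * turn Z).
  split; first by split.
  split; try exact: quot_circle_turn.
  by rewrite !mono; case: h => -[-> ->]; [constructor 1|constructor 2|constructor 3].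
move=> [t1 [t2 [t3 [[i1 i2 i3] [e1 e2 e3 h]]]]].
move: h; rewrite -(expi_inj (itv X) i1) -1?quot_circle_turn //.
rewrite -(expi_inj (itv Y) i2) -1?quot_circle_turn //.
rewrite -(expi_inj (itv Z) i3) -1?quot_circle_turn // !mono.
by case=> /andP[-> ->]; [constructor 1|constructor 2|constructor 3].
Qed.

Lemma quot_circle_embedding : circle_embedding quot_circle.
Proof.
split; [|exact: quot_circleD|exact: quot_circle_inj|exact: quot_circle_cycE].
by move=> X; apply: norm_expi.
Qed.

(** The rotation of [p] is exactly 1/n, and i/n with 1 <= i <= n is an integer only for i = n. *)
Lemma quot_circle_primitive n p : (0 < n)%N -> p *+ n - z \in @uw_core G ->
  n.-primitive_root (quot_circle (lin_class (uw_elt p))).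
Proof.
move=> n0 /(rotation_core R); rewrite raddfB /= raddfMn /= rotation_z => /eqP.
rewrite subr_eq0 => /eqP pn; apply/andP; split=> //; apply/forallP => i.
rewrite unity_rootE quot_circleE -uw_circleX; apply/eqP; apply/eqP/eqP => [|iE].
  move=> /uw_circle_eq1/lin_part_rot[k]; rewrite raddfMn /= => kE.
  have : (i.+1%:Z)%:~R = (k * n%:Z)%:~R :> R.
    by rewrite intrM -kE -!pmulrn mulr_natr mulrnAC pn.
  move/eqP; rewrite eqr_int => /eqP ik; have := ltn_ord i.
  have [k1|k1|k1] := ltgtP k 1; [|nia|rewrite k1 in ik; lia].
  have : k * n%:Z <= 0 by rewrite pmulr_lle0; lia.
  by lia.
by rewrite iE; apply/uw_circle_eq1/lin_part_rot; exists 1; rewrite raddfMn /= pn.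
Qed.

End CircleEmbedding.

(** * Quotients by c-convex subgroups *)

Lemma zmod_closed_pack (V : zmodType) (S : {pred V}) : zmod_closed S ->
  exists S' : zmodClosed V, S' = S :> {pred V}.
Proof.
move=> zS; pose S' : zmodClosed V := HB.pack S (GRing.isZmodClosed.Build V S zS).
by exists S'.
Qed.

Section Quotient.
Variables (V : zmodType) (H : zmodClosed V).
Local Notation Q := (Quotient.quot H).
Definition quot_class (a : V) : Q := \pi_Q%qT a.

Lemma quot_classP a b : quot_class a = quot_class b <-> a - b \in H.
Proof. by rewrite Quotient.idealrBE; split=> [h|/eqP h //]; apply/eqP. Qed.

Lemma quot_class_surj X : exists a, quot_class a = X.
Proof. by exists (repr X); rewrite /quot_class reprK. Qed.

Lemma quot_class_is_additive : zmod_morphism quot_class.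
Proof. exact: (@pi_is_zmod_morphism _ _ _ Q). Qed.

HB.instance Definition _ := GRing.isZmodMorphism.Build V Q quot_class quot_class_is_additive.

Lemma quot_class0 a : quot_class a = 0 <-> a \in H.
Proof. by rewrite -(raddf0 quot_class) quot_classP subr0. Qed.
End Quotient.

(** * c-divisibility of the quotients, and divisibility in the unwound *)

Section CyclicallyDivisible.
Variables (R : realType) (G : cycZmodType) (n : nat).
Hypothesis n2 : (2 <= n)%N.
Implicit Types (p q d e h : uw G) (a b g : G).
Local Notation z := (uw_z G).
Local Notation core := (@uw_core G).
Local Notation lpart := (@lin_part G).

(** The element [u] represents the preimage of [zeta], and its order modulo [H] is that of
    [zeta]. *)
Lemma c_n_divisibleP (V : zmodType) (H : zmodClosed V) :
  c_n_divisible R n (Quotient.quot H) ->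
  (forall g : V, exists y, g - y *+ n \in H) /\
  exists u : V, forall k, (u *+ k \in H) = (n %| k)%N.
Proof.
move=> [ndiv [S [zeta [f [zprim fD finj fim]]]]]; split=> [g|].
  have [X XE] := ndiv (quot_class H g); have [y yE] := quot_class_surj X.
  by exists y; apply/quot_classP; rewrite raddfMn /= yE XE.
have [a aS fa] : exists2 a, a \in S & f a = zeta by apply/fim; exists 1%N.
(* [f 0] is idempotent and, being a power of [zeta], nonzero. *)
have f0 : f 0 = 1.
  have [k f0k] : exists k, f 0 = zeta ^+ k by apply/fim; exists 0; rewrite ?rpred0.
  have f0n : f 0 != 0.
    rewrite f0k expf_neq0 //; apply/eqP => z0; have := prim_expr_order zprim.
    by rewrite z0 expr0n; case: n n2 => // m _ /eqP; rewrite eq_sym oner_eq0.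
  by apply: (mulIf f0n); rewrite mul1r -fD ?rpred0 // addr0.
have fX k : f (a *+ k) = zeta ^+ k.
  elim: k => [|k IH]; first by rewrite mulr0n f0.
  by rewrite mulrSr fD ?rpredMn // IH fa exprSr.
have [u uE] := quot_class_surj a; exists u => k.
rewrite (prim_order_dvd zprim) -fX -f0; apply/idP/eqP => [uk|/finj h].
  by congr f; rewrite -uE -raddfMn; apply/quot_class0.
by apply/quot_class0; rewrite raddfMn /= uE h ?rpred0 ?rpredMn.
Qed.

Lemma uw_convex_le (H : {pred uw G}) p d e : convex (@uw_lt G) H ->
  d \in H -> e \in H -> uw_le d p -> uw_le p e -> p \in H.
Proof. by move=> cH dH eH [<- //|dp] [-> //|pe]; apply: (cH d e). Qed.

Lemma uw_divisible_mod (H : {pred uw G}) :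
  (forall H' : zmodClosed G, proper_c_convex H' -> c_n_divisible R n (Quotient.quot H')) ->
  zmod_closed H -> convex (@uw_lt G) H -> {subset H <= core} ->
  (exists2 e, e \in H & e != 0) -> forall p, exists y, p - y *+ n \in H.
Proof.
move=> div zH cH HC [e eH e0].
have [K KE] := zmod_closed_pack zH; subst H.
(* [I], the image of [K] in [G], is the proper c-convex subgroup to which [div] is applied. *)
have zI : zmod_closed [pred a : G | `[< exists2 p, p \in K & uw_elt p = a >]].
  split; first by apply/asboolP; exists 0; rewrite ?rpred0.
  move=> _ _ /asboolP[p pK <-] /asboolP[q qK <-]; apply/asboolP.
  by exists (p - q); rewrite ?rpredB ?raddfB.
have [I IE] := zmod_closed_pack zI.
have IP a : a \in I <-> exists2 p, p \in K & uw_elt p = a.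
  by rewrite IE; split=> [/asboolP|?] //; apply/asboolP.
have pI : proper_c_convex I.
  split.
  - by move=> _ /IP[p pK <-]; apply/uw_elt_core/HC.
  - move=> _ _ x /IP[p pK <-] /IP[q qK <-] [p' [x' [p'C x'C /(uw_core_inj p'C (HC _ pK)) -> x'E px]]].
    move=> [x'' [q' [x''C q'C x''E /(uw_core_inj q'C (HC _ qK)) -> xq]]].
    have xx : x'' = x' by apply: uw_core_inj; rewrite ?x'E.
    by apply/IP; exists x' => //; apply: cH pK qK px _; rewrite -xx.
  - exists (uw_elt e); first by apply/IP; exists e.
    apply: contraNneq e0 => e0; apply/eqP.
    by apply: uw_core_inj; rewrite ?rpred0 ?HC ?e0.
have [ndiv [u uP]] := c_n_divisibleP (div I pI).
(* Convex subgroups are pure: a nonnegative element lies between 0 and its multiples. *)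
have Kdiv q k : q *+ k.+1 \in K -> q \in K.
  wlog q0 : q / uw_le 0 q => [W|].
    have [/W //|/uw_ltNge/uw_lt_le q0 qK] := pselect (uw_le 0 q).
    rewrite -rpredN; apply: W; first exact/uw_oppr_ge0.
    by rewrite mulNrn rpredN.
  move=> qK; apply: (uw_convex_le cH (rpred0 _) qK) => //.
  by rewrite -{1}[q]mulr1n; apply: uw_leMn2.
pose U : uw G := Uw 0 u.
have lift p q : uw_elt p - uw_elt q \in I -> exists (m : int) c, c \in K /\ p - q - c = z *~ m.
  move=> /IP[c cK cE]; exists (uw_int (p - q - c)), c; split=> //.
  by apply: uw_elt_eq; rewrite cE raddfB.
have n0 : (0 < n)%N by apply: ltnW.
have [k [c [cK Uk]]] : exists (m : int) c, c \in K /\ U *+ n - 0 - c = z *~ m.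
  by apply: lift; rewrite raddf0 addr0 raddfMn /= uP.
(* If m divides k and n, purity puts (n/m) U - (k/m) z in [K]; then (n/m) u is in [I], so n divides
   n/m and m = 1. *)
have /coprimezP[[a b] /= abE] : coprimez k n.
  rewrite /coprimez /gcdz; set m := gcdn _ _; apply/eqP; congr Posz.
  have m0 : (0 < m)%N by rewrite gcdn_gt0 n0 orbT.
  have /dvdnP[n' nE] : (m %| n)%N by apply: dvdn_gcdr.
  have /dvdzP[k' kE] : (m %| k)%Z by apply: dvdn_gcdl.
  have : U *+ n' - z *~ k' \in K.
    apply: (@Kdiv _ m.-1); rewrite prednK //.
    have -> : (U *+ n' - z *~ k') *+ m = U *+ n - z *~ k by rewrite kE nE; zmod.
    by rewrite -Uk; have -> : U *+ n - (U *+ n - 0 - c) = c by zmod.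
  move=> UK; have : u *+ n' \in I.
    apply/IP; exists (U *+ n' - z *~ k') => //.
    by rewrite raddfB /= uw_eltZ subr0 raddfMn.
  rewrite uP nE => /dvdnP[j jE].
  have n'0 : (0 < n')%N by lia.
  have : (j * m * n' == 1 * n')%N by apply/eqP; rewrite mul1n {2}jE; lia.
  by rewrite eqn_pmul2r // muln_eq1 => /andP[_ /eqP].
(* From a k + b n = 1 and k z = n U - c follows z = n (a U + b z) - a c. *)
have zdiv : exists w d, d \in K /\ z = w *+ n + d.
  exists (U *~ a + z *~ b), (- (c *~ a)); split; first by rewrite rpredN rpredMz.
  have {1}-> : z = z *~ (a * k + b * n) by rewrite abE mulr1z.
  have -> : z *~ (a * k + b * n) = z *~ k *~ a + z *~ b *+ n by zmod.
  by rewrite -Uk; zmod.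
(* Dividing in G/I leaves an error in K plus a multiple m z, and the latter is divided through
   [zdiv]. *)
move=> p; have [y yI] := ndiv (uw_elt p).
have [m [c' [c'K pE]]] : exists (m : int) c, c \in K /\ p - (Uw 0 y) *+ n - c = z *~ m.
  by apply: lift; rewrite raddfMn.
have [w [d [dK zE]]] := zdiv.
exists (Uw 0 y + w *~ m).
have -> : p - (Uw 0 y + w *~ m) *+ n = c' + d *~ m.
  have -> : p = z *~ m + c' + Uw 0 y *+ n by rewrite -pE; zmod.
  by rewrite zE; zmod.
by rewrite rpredD ?rpredMz.
Qed.

(** For 0 < c in [H] and p >= 0, regularity applied to the points p + i c gives n y - p between c
    and n c, hence in [H]. *)
Lemma lin_divisible_mod (H : zmodClosed G) : n_regular (@lin_order G) n ->
  proper_c_convex H -> forall a, a \in lpart -> exists2 v, v \in lpart & a - v *+ n \in H.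
Proof.
move=> reg [HL cH [h0 h0H h0n]].
have [c cC [cH' c0]] : exists2 c, c \in core & uw_elt c \in H /\ uw_lt 0 c.
  have /asboolP[c cC cE] := HL _ h0H.
  have c0 : c <> 0 by move=> c0; rewrite -cE c0 raddf0 eqxx in h0n.
  have [c0'|c0'] := lgo_total (uw_ltP G) c0; last by exists c => //; rewrite cE.
  exists (- c); rewrite ?rpredN //; split; last exact: lgo_opp0 (uw_ltP G) _ c0'.
  by rewrite cE.
have H_le p d e : d \in core -> e \in core -> uw_elt d \in H -> uw_elt e \in H ->
    uw_le d p -> uw_le p e -> uw_elt p \in H.
  move=> dC eC dH eH dp pe; have pC := uw_core_le dC eC dp pe.
  case: dp pe => [<- //|dp] [-> //|pe].
  by apply: cH dH eH _ _; apply/lin_ltE.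
have main p : p \in core -> uw_le 0 p ->
    exists2 v, v \in lpart & uw_elt p - v *+ n \in H.
  move=> pC p0.
  have xC i : p + c *+ i \in core by rewrite rpredD ?rpredMn.
  have [||y [y1 y2]] := reg (fun i => Lin (uw_elt_core (xC i))).
  - suff h : lin_lt (uw_elt (0 : uw G)) (uw_elt (p + c *+ 1)) by [].
    by apply/lin_ltE; rewrite ?rpred0 // addrC; apply: uw_lt0D.
  - move=> i _.
    suff h : lin_lt (uw_elt (p + c *+ i)) (uw_elt (p + c *+ i.+1)) by [].
    apply/lin_ltE => //.
    by apply/uw_ltB; have -> : p + c *+ i.+1 - (p + c *+ i) = c by zmod.
  have /asboolP[Y YC YE] := valP y.
  have YnC : Y *+ n \in core by rewrite rpredMn.
  have yn : lin_val (y *+ n) = uw_elt (Y *+ n) by rewrite -[lin_val _]/(val _) !raddfMn /= YE.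
  have Y1 : uw_le (p + c *+ 1) (Y *+ n).
    case: y1 => [y1|y1]; [left|by right; apply/lin_ltE => //; rewrite -yn].
    by apply: uw_core_inj; rewrite // -yn -y1.
  have Y2 : uw_le (Y *+ n) (p + c *+ n).
    case: y2 => [y2|y2]; [left|by right; apply/lin_ltE => //; rewrite -yn].
    by apply: uw_core_inj; rewrite // -yn y2.
  exists (uw_elt Y); first exact: uw_elt_core.
  rewrite -raddfMn -raddfB -rpredN -raddfN opprB.
  apply: (H_le _ c (c *+ n)); rewrite ?rpredMn // ?raddfMn ?rpredMn //.
    apply/uw_leB; have -> : Y *+ n - p - c = Y *+ n - (p + c *+ 1) by zmod.
    exact: (uw_le_sub Y1).
  apply/uw_leB; have -> : c *+ n - (Y *+ n - p) = p + c *+ n - Y *+ n by zmod.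
  exact: (uw_le_sub Y2).
move=> _ /asboolP[p pC <-].
have [p0|/uw_ltNge p0] := pselect (uw_le 0 p); first exact: main.
have [||v vL vH] := main (- p); rewrite ?rpredN //.
  exact/uw_oppr_ge0/uw_lt_le.
exists (- v); rewrite ?rpredN // -rpredN opprB mulNrn.
by have -> : - (v *+ n) - uw_elt p = uw_elt (- p) - v *+ n by rewrite raddfN addrC.
Qed.

Lemma quot_c_n_divisible (H : zmodClosed G) (f : quot_lin G -> R[i]) x :
  n_regular (@lin_order G) n -> n_divisible n (quot_lin G) ->
  circle_embedding f -> n.-primitive_root (f x) ->
  proper_c_convex H -> c_n_divisible R n (Quotient.quot H).
Proof.
move=> lreg Kdiv [_ fD finj _] xprim pH.
have ldiv := lin_divisible_mod lreg pH.
have HL : {subset H <= lpart} by case: pH.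
have f0 : f 0 = 1.
  have x0 : f x != 0.
    apply/eqP => x0; have := prim_expr_order xprim.
    by rewrite x0 expr0n; case: n n2 => // m _ /eqP; rewrite eq_sym oner_eq0.
  by apply: (mulIf x0); rewrite mul1r -fD add0r.
have fX X k : f (X *+ k) = f X ^+ k.
  by elim: k => [|k IH]; rewrite ?f0 // mulrSr fD IH exprSr.
split.
  (* Divide in K(G), then divide the error, which is in l(G), modulo [H]. *)
  move=> X; have [g <-] := quot_class_surj X.
  have [Y YE] := Kdiv (lin_class g); have [a aE] := lin_class_surj Y.
  have : a *+ n - g \in lpart by apply/lin_classP; rewrite raddfMn /= aE YE.
  move=> /ldiv[v _ vH]; exists (quot_class H (a - v)).
  rewrite -raddfMn; apply/quot_classP.
  by have -> : (a - v) *+ n - g = a *+ n - g - v *+ n by zmod.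
have [u ux uH] : exists2 u, lin_class u = x & u *+ n \in H.
  have [u0 u0E] := lin_class_surj x.
  have : u0 *+ n - 0 \in lpart.
    apply/lin_classP; rewrite raddfMn raddf0 /= u0E; apply: finj.
    by rewrite fX (prim_expr_order xprim).
  move=> /ldiv[v vL vH]; exists (u0 - v); last by rewrite mulrnBl -[u0 *+ n]subr0.
  by rewrite -u0E; apply/lin_classP; rewrite addrAC subrr sub0r rpredN.
pose w := quot_class H u.
have wn : w *+ n = 0 by rewrite -raddfMn; apply/quot_class0.
have zS : zmod_closed [pred a | `[< exists k, a = w *+ k >]].
  split; first by apply/asboolP; exists 0%N.
  (* As n w = 0, the opposite of k w is k (n - 1) w, so natural multiples suffice. *)
  move=> _ _ /asboolP[j ->] /asboolP[k ->]; apply/asboolP; exists (j + k * n.-1)%N.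
  have wk : w *+ k = w *+ n *+ k - w *+ n.-1 *+ k.
    by rewrite -{1}(prednK (ltnW n2)); zmod.
  by rewrite wk wn; zmod.
have [S SE] := zmod_closed_pack zS.
have SP (a : Quotient.quot H) : a \in S <-> exists k, a = w *+ k.
  by rewrite SE; split=> [/asboolP|?] //; apply/asboolP.
(* [F] is G/H -> K(G) followed by [f]; it is independent of representatives since [H] is inside
   l(G), and injective on [S] because n w = 0 and [f x] has order n. *)
pose F (a : Quotient.quot H) := f (lin_class (repr a)).
have FE g : F (quot_class H g) = f (lin_class g).
  congr f; apply/lin_classP/HL/quot_classP.
  by rewrite /quot_class reprK.
have Fw k : F (w *+ k) = f x ^+ k by rewrite -raddfMn FE raddfMn /= ux fX.
exists S, (f x), F; split=> //.
- by move=> _ _ /SP[i ->] /SP[j ->]; rewrite -mulrnDr !Fw exprD.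
- move=> _ _ /SP[i ->] /SP[j ->]; rewrite !Fw => /eqP.
  rewrite (eq_prim_root_expr xprim) => /eqP ij.
  have mod k : w *+ k = w *+ (k %% n).
    by rewrite {1}(divn_eq k n) mulrnDr mulnC mulrnA wn mul0rn add0r.
  by rewrite mod ij -mod.
- move=> t; split=> [[a /SP[k ->] <-]|[k ->]]; first by exists k; rewrite Fw.
  by exists (w *+ k); rewrite ?Fw //; apply/SP; exists k.
Qed.

End CyclicallyDivisible.

Theorem theorem3p12 (R : realType) (n : nat) (hn : (2 <= n)%N)
    (G : cycZmodType) :
  [<->
    n_regular (@uw_lt G) n;
    c_n_regular n G;
    c_archimedean G \/
      [/\ n_regular (@lin_order G) n,
          n_divisible n (quot_lin G) &
          exists f : quot_lin G -> R[i],
            circle_embedding f /\ exists x, n.-primitive_root (f x)];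
    forall H : zmodClosed G, proper_c_convex H ->
      c_n_divisible R n (Quotient.quot H)].
Proof.
tfae.
- exact: c_regular_of_regular.
- move=> reg; have [|/existsNP[g /not_implyP[gL g0]]] := pselect (c_archimedean G).
    by left.
  right; move: gL => /asboolP[c cC cE].
  have c0 : c <> 0 by move=> c0; apply: g0; rewrite -cE c0 raddf0.
  (* A positive element of the core serves as the step of the sequences fed to c-regularity. *)
  have {g cE g0} [{}c {}cC {}c0] : exists2 c, c \in @uw_core G & uw_lt 0 c.
    have [c0'|c0'] := lgo_total (uw_ltP G) c0; last by exists c.
    by exists (- c); rewrite ?rpredN //; exact: lgo_opp0 (uw_ltP G) _ c0'.
  split; first exact: c_regular_lin_part.
    move=> X; have [g <-] := lin_class_surj X.
    have [y yL] := c_regular_quot_divisible hn reg cC c0 g.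
    by exists (lin_class y); rewrite -raddfMn; apply/lin_classP.
  exists (quot_circle R (G := G)); split; first exact: quot_circle_embedding.
  have [Y YC] := c_regular_root hn reg cC c0.
  by exists (lin_class (uw_elt Y)); apply: quot_circle_primitive => //; apply: ltnW.
- move=> [arch H [HL _ [h hH]]|[lreg Kdiv [f [fE [x xprim]]]] H pH].
    (* With l(G) trivial there is no proper c-convex subgroup. *)
    by rewrite (arch h (HL h hH)) eqxx.
  exact: quot_c_n_divisible lreg Kdiv fE xprim pH.
- move=> div; apply: uw_regular_of_divisible => // H zH cH HC He.
  exact: uw_divisible_mod div zH cH HC He.
Qed.
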